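(* Up to isomorphism and trivial equivalences, there are exactly five 3-cell templates $\mathcal{C}$ (alias Thom-Smale complexes of Sturm 3-ball global attractors) whose underlying cell complex is the solid octahedron. All five have pole distance $\delta=1$; four of them have smaller-hemisphere face count $\eta=1$, and one of them has $\eta=2$.
   Context: A finite regular CW-complex $\mathcal{C}=\bigcup_{v\in\mathcal{E}}c_v$ is a finite disjoint union of open cells $c_v$, labeled by barycenters $v\in\mathcal{E}$, whose characteristic maps $\overline{B}_v\to\overline{c}_v$ are homeomorphisms (including on the boundary) and such that each boundary $\partial c_v$ is a subcomplex of the skeleton of lower dimension. Cells of dimension 0, 1, 2 are called vertices, edges, faces. A bipolar orientation of the 1-skeleton is an orientation of all edges without directed cycles and with exactly one ''source'' vertex $\mathbf{N}$ (North pole) and exactly one ''sink'' vertex $\mathbf{S}$ (South pole). A finite regular cell complex $\mathcal{C}$ is called a 3-cell template if all of the following hold. (i) $\mathcal{C}=\mathrm{clos}\,c_{\mathcal{O}}=S^2\,\dot\cup\,c_{\mathcal{O}}$ is the closure of a single 3-cell $c_{\mathcal{O}}$. (ii) The 1-skeleton $\mathcal{C}^1$ carries a bipolar orientation from a pole vertex $\mathbf{N}$ to a pole vertex $\mathbf{S}$, with two directed meridian paths $\mathbf{WE}$ and $\mathbf{EW}$ from $\mathbf{N}$ to $\mathbf{S}$, disjoint except for the poles. The meridians decompose the boundary sphere $S^2=\partial c_{\mathcal{O}}$ into two remaining (open) hemisphere components $\mathbf{W}$ (West) and $\mathbf{E}$ (East). (iii) At end points on the meridians other than the poles $\mathbf{N},\mathbf{S}$,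 edges in $\mathbf{W}$ are directed towards the meridians and edges in $\mathbf{E}$ are directed away from the meridians. (iv) Let $\mathbf{NE}$ be the unique face in $\mathbf{W}$ containing the first edge of $\mathbf{WE}$ in its boundary, and $\mathbf{SW}$ the unique face in $\mathbf{E}$ containing the last edge of $\mathbf{WE}$ in its boundary. Then the boundaries of $\mathbf{NE}$ and $\mathbf{SW}$ share at least one edge of $\mathbf{WE}$. Similarly, let $\mathbf{NW}$ be the unique face in $\mathbf{W}$ adjacent to the first edge of $\mathbf{EW}$, and $\mathbf{SE}$ the unique face in $\mathbf{E}$ adjacent to the last edge of $\mathbf{EW}$. Then their boundaries share at least one edge of $\mathbf{EW}$. The data of a 3-cell template are the complex together with the bipolar orientation, the poles, the labeled meridians, and the labeled hemispheres; isomorphisms are cell-preserving homeomorphisms respecting all these data. Trivial equivalences: the Klein 4-group generated by two commuting involutions. $\kappa$ reverses all edge orientations and interchanges the labels $\mathbf{N}\leftrightarrow\mathbf{S}$, $\mathbf{WE}\leftrightarrow\mathbf{EW}$, $\mathbf{W}\leftrightarrow\mathbf{E}$. $\rho$ keeps all edge orientations, poles, and the labels of $\mathbf{W},\mathbf{E}$, and interchanges $\mathbf{WE}\leftrightarrow\mathbf{EW}$. The solid octahedron is the regular cell complex of a 3-cell whose boundary sphere complex is the boundary complex of the convex regular octahedron (6 vertices, 12 edges, 8 triangular faces). The pole distance $\delta$ is the edge distance of $\mathbf{N}$ and $\mathbf{S}$ in the 1-skeleton $\mathcal{C}^1$. The number $\eta$ is the number of faces in the hemisphere ($\mathbf{W}$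 or $\mathbf{E}$) with fewer faces; by the trivial equivalence $\kappa$ this may be taken to be $\mathbf{W}$. Background: by earlier work of the same authors, 3-cell templates are exactly the Thom-Smale complexes (decompositions into unstable manifolds of equilibria, with signed hemisphere decomposition) of Sturm 3-ball global attractors of dissipative PDEs $u_t=u_{xx}+f(x,u,u_x)$ on $0<x<1$ with Neumann boundary conditions and hyperbolic equilibria, and the template determines the Sturm permutation uniquely. *)

(* Defs.v *)
From HB Require Import structures.
From mathcomp Require Import all_boot all_order all_algebra.
From mathcomp Require Import all_classical all_reals all_analysis.

Set Implicit Arguments.
Unset Strict Implicit.
Unset Printing Implicit Defensive.

Import Order.TTheory GRing.Theory Num.Theory.
Import numFieldNormedType.Exports.

Local Open Scope classical_set_scope.
Local Open Scope ring_scope.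

(* [f] restricts to a homeomorphism from the subspace [A] onto the subspace
   [B]; values outside [A] are irrelevant. *)
Definition homeomorphism_on (X Y : topologicalType) (A : set X) (B : set Y)
    (f : X -> Y) : Prop :=
  exists g : Y -> X,
    [/\ {within A, continuous f}, {within B, continuous g},
        f @` A = B & forall x, A x -> g (f x) = x].

(* Euclidean balls: the norm of the library on ['rV[R]_n] is the sup norm,
   so its [ball] is a cube. *)
Definition open_unit_ball (R : realType) (n : nat) : set 'rV[R]_n :=
  [set x : 'rV[R]_n | \sum_(i < n) x ord0 i ^+ 2 < 1].

Definition closed_unit_ball (R : realType) (n : nat) : set 'rV[R]_n :=
  [set x : 'rV[R]_n | \sum_(i < n) x ord0 i ^+ 2 <= 1].

(* Finite families of labeled cells in a topological space. The complex
   itself is the subspace [carrier C] of the ambient space. *)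
Record cell_complex := CellComplex {
  ambient : topologicalType;
  label : finType;
  cdim : label -> nat;
  cell : label -> set ambient
}.

Definition carrier (C : cell_complex) : set (ambient C) :=
  \bigcup_v cell v.

Arguments carrier C : clear implicits.

Definition cboundary (C : cell_complex) (v : label C) : set (ambient C) :=
  closure (cell v) `\` cell v.

Definition is_vertex (C : cell_complex) (v : label C) : bool := cdim v == 0%N.
Definition is_edge (C : cell_complex) (v : label C) : bool := cdim v == 1%N.
Definition is_face (C : cell_complex) (v : label C) : bool := cdim v == 2%N.

Record regular_cell_complex (R : realType) (C : cell_complex) : Prop := {
  rcc_hausdorff : hausdorff_space (ambient C);
  rcc_disjoint : trivIset setT (@cell C);
  rcc_characteristic : forall v : label C,
    exists2 f : 'rV[R]_(cdim v) -> ambient C,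
      homeomorphism_on (@closed_unit_ball R (cdim v)) (closure (cell v)) f
      & f @` @open_unit_ball R (cdim v) = cell v;
  rcc_boundary : forall v : label C,
    exists2 A : set (label C),
      cboundary v = \bigcup_(w in A) cell w
      & forall w, A w -> (cdim w < cdim v)%N
}.

(* Cell-preserving homeomorphisms [f], with induced map [phi] on labels. *)
Record complex_isomorphism (C D : cell_complex)
    (f : ambient C -> ambient D) (phi : label C -> label D) : Prop := {
  ci_homeo : homeomorphism_on (carrier C) (carrier D) f;
  ci_bij : bijective phi;
  ci_dim : forall v, cdim (phi v) = cdim v;
  ci_cell : forall v, f @` cell v = cell (phi v)
}.

Definition complex_isomorphic (C D : cell_complex) : Prop :=
  exists f phi, @complex_isomorphism C D f phi.

(* The solid regular octahedron |x_0| + |x_1| + |x_2| <= 1. The open faces of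
   its boundary are labeled by the nonzero sign vectors: the face of [s] is
   the open simplex spanned by the vectors [s_i e_i] with [s_i] nonzero. The
   zero sign vector labels the open 3-cell. *)
Definition sign_val (R : realType) (s : option bool) : R :=
  match s with Some true => 1 | Some false => -1 | None => 0 end.

Definition octahedron_cdim (s : {ffun 'I_3 -> option bool}) : nat :=
  if #|[pred i | s i != None]| is k.+1 then k else 3%N.

Definition octahedron_cell (R : realType) (s : {ffun 'I_3 -> option bool}) :
    set 'rV[R]_3 :=
  if [forall i, s i == None] then
    [set x : 'rV[R]_3 | \sum_(i < 3) `|x ord0 i| < 1]
  else
    [set x : 'rV[R]_3 | \sum_(i < 3) `|x ord0 i| = 1
             /\ forall i, Num.sg (x ord0 i) = sign_val R (s i)].

Definition solid_octahedron (R : realType) : cell_complex :=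
  @CellComplex 'rV[R]_3 {ffun 'I_3 -> option bool}
    octahedron_cdim (@octahedron_cell R).

(* The data of a 3-cell template. An orientation is given by the tail and
   head of each edge; [etail] and [ehead] carry no information on other cells.
   A path is the list of its successive edges. The hemispheres are subsets of
   the ambient space. *)
Record template_data := TemplateData {
  complex :> cell_complex;
  etail : label complex -> label complex;
  ehead : label complex -> label complex;
  poleN : label complex;
  poleS : label complex;
  WE : seq (label complex);
  EW : seq (label complex);
  hemiW : set (ambient complex);
  hemiE : set (ambient complex)
}.

Arguments hemiW t : clear implicits.
Arguments hemiE t : clear implicits.

Section Templates.
Variable d : template_data.
Implicit Types (e u v : label d) (p : seq (label d)).

Definition is_orientation : Prop :=
  forall e, is_edge e ->
    etail e != ehead e /\ cboundary e = cell (etail e) `|` cell (ehead e).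

Fixpoint dipath u p v : bool :=
  if p is e :: p' then [&& is_edge e, etail e == u & dipath (ehead e) p' v]
  else u == v.

Definition is_source v : Prop :=
  is_vertex v /\ forall e, is_edge e -> ehead e <> v.

Definition is_sink v : Prop :=
  is_vertex v /\ forall e, is_edge e -> etail e <> v.

Definition is_bipolar : Prop :=
  [/\ is_orientation,
      forall v p, dipath v p v -> p = [::],
      forall v, is_source v <-> v = poleN d
    & forall v, is_sink v <-> v = poleS d].

Definition path_support p : set (ambient d) :=
  \bigcup_(e in [set` p]) closure (cell e).

Definition meridians : set (ambient d) :=
  path_support (WE d) `|` path_support (EW d).

Definition in_hemisphere (H : set (ambient d)) v : Prop := cell v `<=` H.

Definition incident v w : Prop := cell v `<=` closure (cell w).

Definition face_at (H : set (ambient d)) e (f : label d) : Prop :=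
  [/\ is_face f, in_hemisphere H f & incident e f].

(* Overlap condition along the meridian [p]: the face in [W] at the first edge
   of [p] and the face in [E] at the last edge of [p] share an edge of [p].
   Meridians are nonempty, so the default values of [head] and [last] are
   irrelevant. *)
Definition overlap p : Prop :=
  exists fW fE,
    [/\ unique (face_at (hemiW d) (head (poleN d) p)) fW,
        unique (face_at (hemiE d) (last (poleN d) p)) fE
      & exists2 e, e \in p & incident e fW /\ incident e fE].

(* The boundary of the 3-cell is a 2-sphere by regularity. *)
Record is_template (R : realType) : Prop := {
  tpl_regular : regular_cell_complex R d;
  tpl_bipolar : is_bipolar;
  tpl_WE : dipath (poleN d) (WE d) (poleS d);
  tpl_EW : dipath (poleN d) (EW d) (poleS d);
  tpl_disjoint : path_support (WE d) `&` path_support (EW d)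
                 = cell (poleN d) `|` cell (poleS d);
  tpl_ball : exists O : label d,
    [/\ cdim O = 3%N, carrier d = closure (cell O),
        hemiW d <> hemiE d
      & forall H : set (ambient d),
          (exists2 x, (cboundary O `\` meridians) x
                      & H = connected_component (cboundary O `\` meridians) x)
          <-> H = hemiW d \/ H = hemiE d];
  tpl_towards : forall e v,
    is_edge e -> in_hemisphere (hemiW d) e -> is_vertex v -> incident v e ->
    cell v `<=` meridians -> v <> poleN d -> v <> poleS d -> v = ehead e;
  tpl_away : forall e v,
    is_edge e -> in_hemisphere (hemiE d) e -> is_vertex v -> incident v e ->
    cell v `<=` meridians -> v <> poleN d -> v <> poleS d -> v = etail e;
  tpl_overlap_WE : overlap (WE d);
  tpl_overlap_EW : overlap (EW d)
}.

Definition skeleton_adj : rel (label d) := fun u v =>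
  [exists e, is_edge e && (((etail e == u) && (ehead e == v))
                        || ((etail e == v) && (ehead e == u)))].

Definition skeleton_walk u v (n : nat) : Prop :=
  exists p, [/\ path skeleton_adj u p, last u p = v & size p = n].

Definition pole_distance (n : nat) : Prop :=
  skeleton_walk (poleN d) (poleS d) n
  /\ forall m, skeleton_walk (poleN d) (poleS d) m -> (n <= m)%N.

Definition face_count (H : set (ambient d)) : nat :=
  #|[pred f : label d | is_face f && `[< in_hemisphere H f >]]|.

Definition smaller_face_count : nat :=
  minn (face_count (hemiW d)) (face_count (hemiE d)).

End Templates.

Record template_isomorphism (d d' : template_data)
    (f : ambient d -> ambient d') (phi : label d -> label d') : Prop := {
  ti_complex : complex_isomorphism f phi;
  ti_tail : forall e, is_edge e -> etail (phi e) = phi (etail e);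
  ti_head : forall e, is_edge e -> ehead (phi e) = phi (ehead e);
  ti_N : phi (poleN d) = poleN d';
  ti_S : phi (poleS d) = poleS d';
  ti_WE : map phi (WE d) = WE d';
  ti_EW : map phi (EW d) = EW d';
  ti_W : f @` hemiW d = hemiW d';
  ti_E : f @` hemiE d = hemiE d'
}.

Definition template_isomorphic (d d' : template_data) : Prop :=
  exists f phi, @template_isomorphism d d' f phi.

(* Reversing all edges reverses the order in which paths traverse them. *)
Definition kappa (d : template_data) : template_data :=
  @TemplateData (complex d) (@ehead d) (@etail d) (poleS d) (poleN d)
    (rev (EW d)) (rev (WE d)) (hemiE d) (hemiW d).

Definition rho (d : template_data) : template_data :=
  @TemplateData (complex d) (@etail d) (@ehead d) (poleN d) (poleS d)
    (EW d) (WE d) (hemiW d) (hemiE d).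

(* [kappa] and [rho] are commuting involutions, so the four elements of the
   group they generate are [kappa^a rho^b] with [a], [b] booleans. *)
Definition trivial_equivalence (a b : bool) (d : template_data) :
    template_data :=
  iter a kappa (iter b rho d).

Definition template_equivalent (d d' : template_data) : Prop :=
  exists a b, template_isomorphic (trivial_equivalence a b d) d'.

Definition octahedral_template (R : realType) (d : template_data) : Prop :=
  is_template d R /\ complex_isomorphic d (solid_octahedron R).

(* Main.v *)
(** Write cells of the complex as labels. Incidence [cell u `<=` closure (cell v)]
    and the partition into cells determine the topological data of a template: a
    union of cells is determined by its set of labels, and the connected component
    of a point in it consists of the cells linked to the cell of that point by a
    chain of incidences, because this union of cells is connected and both open and
    closed. Hence being a template is a finite combinatorial condition on the
    labels, invariant under transport along cell-preserving homeomorphisms.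

    For the octahedron the symmetry group of order 48 acts by homeomorphisms, so one
    may assume that N is a fixed vertex and that S is a fixed neighbour of N or the
    antipode of N. Then at most 5 edges are still unoriented, and a finite
    enumeration shows that the antipodal case is impossible and that every template
    with adjacent poles is equivalent to one of five. When W is the hemisphere with
    fewer faces, four of them have the triangle on N, S and a common neighbour m as
    their only western face, and differ by the order of the three vertices antipodal
    to N, S and m along the orientation; in the fifth one W is a pair of triangles
    separated by the edge NS.

    The five are pairwise inequivalent. The numbers of faces of W and E rule out
    [kappa] and single out the fifth template, while [rho] does not change the
    oriented graph, and the sum of outdeg (tail) * outdeg (head) over its edges
    takes four different values on the other four. *)

From HB Require Import structures.
Require Import Defs.
From mathcomp Require Import all_boot all_order all_algebra.
From mathcomp Require Import all_classical all_reals all_analysis.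
From mathcomp Require Import ring lra.

Set Implicit Arguments.
Unset Strict Implicit.
Unset Printing Implicit Defensive.

Import Order.TTheory GRing.Theory Num.Theory.
Import numFieldNormedType.Exports.

Local Open Scope classical_set_scope.
Local Open Scope ring_scope.

(** * Regular complexes and their cell unions *)

Lemma continuous_rV (X : topologicalType) (R : realType) n (f : X -> 'rV[R]_n) :
  (forall i, continuous (fun x => f x ord0 i)) -> continuous f.
Proof.
move=> fc x A [P fP sPA].
suff : \forall y \near x, forall j, P ord0 j (f y ord0 j).
  by apply: filterS => y /= h; apply: sPA => i j; rewrite ord1.
by apply: filter_forall => j; have := fP ord0 j; exact: (fc j x).
Qed.

(** A nonempty relatively open and closed part of [B] meets [A] by density, hence contains the
    connected set [A]. Being relatively closed, it then contains [B]. *)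
Lemma connected_between (T : topologicalType) (A B : set T) :
  connected A -> A `<=` B -> B `<=` closure A -> connected B.
Proof.
move=> cA AB BA U [z Uz] [C1 oC1 C1E] [C2 cC2 C2E].
suff AU : A `<=` C2.
  rewrite C2E; apply/setIidPl; apply: subset_trans BA _.
  by rewrite [X in _ `<=` X](iffLR (closure_id _) cC2); exact: closureS.
suff /setIidPl : A `&` C2 = A by [].
apply: cA.
- move: Uz; rewrite C1E => -[Bz C1z].
  have [w [Aw C1w]] := BA _ Bz _ (open_nbhs_nbhs (conj oC1 C1z)).
  exists w; split=> //.
  have : U w by rewrite C1E; split=> //; exact: AB.
  by rewrite C2E => -[].
- exists C1 => //; apply/seteqP; split=> w [Aw Cw]; split=> //.
    have : U w by rewrite C2E; split=> //; exact: AB.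
    by rewrite C1E => -[].
  have : U w by rewrite C1E; split=> //; exact: AB.
  by rewrite C2E => -[].
- by exists C2.
Qed.

Lemma open_unit_ball0 (R : realType) n : @open_unit_ball R n 0.
Proof. by rewrite /open_unit_ball /= big1 // => i _; rewrite mxE expr0n. Qed.

Lemma open_closed_unit_ball (R : realType) n :
  @open_unit_ball R n `<=` @closed_unit_ball R n.
Proof. by move=> x /ltW. Qed.

Lemma open_unit_ball_connected (R : realType) n : connected (@open_unit_ball R n).
Proof.
pose seg (x : 'rV[R]_n) := (fun t : R => t *: x) @` `[0, 1].
have -> : @open_unit_ball R n = \bigcup_(x in @open_unit_ball R n) seg x.
  apply/seteqP; split=> [x bx|_ [x bx [t t01 <-]]].
    by exists x => //; exists 1; rewrite ?scale1r //= in_itv /= ler01 lexx.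
  move: t01; rewrite /= in_itv /= => /andP[t0 t1].
  apply: le_lt_trans bx; apply: ler_sum => i _; rewrite mxE exprMn.
  by rewrite ler_piMl ?sqr_ge0 // expr_le1.
apply: bigcup_connected.
  exists 0 => x _; exists 0; rewrite ?scale0r //= in_itv /= lexx ler01 //.
move=> x _; apply: connected_continuous_connected; first exact: segment_connected.
apply: continuous_subspaceT; apply: continuous_rV => i t.
under [fun x0 => _]funext do rewrite mxE.
by apply: cvgM; [exact: cvg_id|exact: cvg_cst].
Qed.

(** Steps may go up or down in [r], and [X] is tested on each cell newly reached. The start [v]
    belongs to its class unconditionally, so users supply [X v] separately. *)
Inductive linked (L : Type) (r : rel L) (X : L -> Prop) (v : L) : L -> Prop :=
| linked0 : linked r X v v
| linkedS u w : linked r X v u -> X w -> r u w || r w u -> linked r X v w.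

Section RegularComplex.
Variables (R : realType) (C : cell_complex).
Hypothesis regC : regular_cell_complex R C.
Implicit Types (u v w : label C) (P Q : set (label C)).

Definition cells P : set (ambient C) := \bigcup_(v in P) cell v.

Lemma cell_nonempty v : cell v !=set0.
Proof.
have [f _ <-] := rcc_characteristic regC v.
by exists (f 0), 0 => //; exact: open_unit_ball0.
Qed.

Lemma cell_connected v : connected (cell v).
Proof.
have [f [g [fc _ _ _]] <-] := rcc_characteristic regC v.
apply: connected_continuous_connected; first exact: open_unit_ball_connected.
by apply: continuous_subspaceW fc; exact: open_closed_unit_ball.
Qed.

Lemma cell_uniq u v x : cell u x -> cell v x -> u = v.
Proof.
by move=> ux vx; apply: (rcc_disjoint regC) => //; exists x.
Qed.

Lemma cells_sub P v : (cell v `<=` cells P) = P v.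
Proof.
apply/propext; split=> [sub|Pv x vx]; last by exists v.
have [x vx] := cell_nonempty v.
by have [w Pw wx] := sub _ vx; rewrite (cell_uniq vx wx).
Qed.

Lemma cellsS P Q : (cells P `<=` cells Q) = (P `<=` Q).
Proof.
apply/propext; split=> [sub v Pv|sub x [v Pv vx]]; last first.
  by exists v => //; exact: sub.
rewrite -(cells_sub Q); apply: subset_trans sub.
by move=> x vx; exists v.
Qed.

Lemma cells_inj P Q : cells P = cells Q -> P = Q.
Proof. by rewrite !eqEsubset !cellsS. Qed.

Lemma cellsU P Q : cells P `|` cells Q = cells (P `|` Q).
Proof. by rewrite /cells bigcup_setU. Qed.

Lemma cellsI P Q : cells P `&` cells Q = cells (P `&` Q).
Proof.
apply/seteqP; split=> [x [[v Pv vx] [w Qw wx]]|x [v [Pv Qv] vx]]; last first.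
  by split; exists v.
by exists v => //; split=> //; rewrite (cell_uniq vx wx).
Qed.

Lemma cellsD P Q : cells P `\` cells Q = cells (P `\` Q).
Proof.
apply/seteqP; split=> [x [[v Pv vx] nQ]|x [v [Pv nQv] vx]].
  by exists v => //; split=> // Qv; apply: nQ; exists v.
split; first by exists v.
by move=> [w Qw wx]; apply: nQv; rewrite (cell_uniq vx wx).
Qed.

Lemma cells1 v : cells [set v] = cell v.
Proof. exact: bigcup_set1. Qed.

Definition cell_le u v : bool := `[< cell u `<=` closure (cell v) >].

Lemma closure_cell_sub v : exists P : set (label C), closure (cell v) = cells P.
Proof.
have [A bE _] := rcc_boundary regC v.
exists ([set v] `|` A).
rewrite -cellsU cells1 /cells -bE /cboundary setDUK //.
exact: subset_closure.
Qed.

(** The boundary axiom makes the closure a union of cells, and a union of disjoint nonempty cells is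
    determined by the cells it contains. *)
Lemma closure_cell v : closure (cell v) = cells [set u | cell_le u v].
Proof.
have [P cE] := closure_cell_sub v; rewrite cE; congr cells.
by apply/funext => u /=; rewrite /cell_le cE cells_sub asboolE.
Qed.

Lemma cboundaryE v : cboundary v = cells [set u | cell_le u v /\ u <> v].
Proof. by rewrite /cboundary closure_cell -[X in _ `\` X]cells1 cellsD. Qed.

Lemma carrierE : carrier C = cells setT. Proof. by []. Qed.

Lemma finite_cells_closed P : closed (\bigcup_(v in P) closure (cell v)).
Proof.
apply: closed_bigcup; last by move=> v _; exact: closed_closure.
exact: finite_finset.
Qed.

(** The linked cells have a connected union, because each step adds a cell incident with the
    previous one. This union is also open and closed in the component: closures of cells are unions
    of cells, and a finite union of such closures is closed. *)
Lemma cells_component (X : set (label C)) v x : X v -> cell v x ->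
  connected_component (cells X) x = cells (linked cell_le X v).
Proof.
move=> Xv vx; set K := linked _ _ _.
have KX : K `<=` X by move=> _ [|u w _ Xw _].
have Kstep u w : K u -> X w -> cell_le u w || cell_le w u -> K w.
  exact: linkedS.
have CCX := @connected_component_sub _ (cells X) x.
have Xsub u : X u -> cell u `<=` cells X by rewrite cells_sub.
apply/seteqP; split; last first.
  (* This union lies between the connected set [cell w] and its closure. *)
  have le_conn u w : cell_le u w -> connected (cell w `|` cell u).
    move=> /asboolP uw; apply: (connected_between (@cell_connected w)).
      by move=> y; left.
    by rewrite subUset; split => //; exact: subset_closure.
  suff sub u : K u -> cell u `<=` connected_component (cells X) x.
    by move=> y [u Ku]; exact: sub.
  elim=> [|{}u w Ku IH Xw uw].
    by apply: connected_component_max (@cell_connected v) => //; exact: Xsub.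
  have conn : connected (cell u `|` cell w).
    by case/orP: uw => /le_conn //; rewrite setUC.
  have [y uy] := cell_nonempty u.
  rewrite (same_connected_component (IH _ uy)).
  apply: (subset_trans (@subsetUr _ (cell u) _)).
  apply: connected_component_max conn; first by left.
  by rewrite subUset; split; apply: Xsub => //; exact: KX.
have xCC : connected_component (cells X) x x.
  by apply: connected_component_refl; exists v.
suff E : connected_component (cells X) x `&` cells K =
    connected_component (cells X) x by rewrite -E => y [].
(* Inside the component, [cells K] is the trace of the closed set formed by the closures of the
   cells of [K], and also of the open complement of the closures of the other cells of [X]. *)
have [openK closedK] : (forall y u, connected_component (cells X) x y -> cell u y ->
    (K u <-> ~ (\bigcup_(w in X `\` K) closure (cell w)) y)) /\
  (forall y u, connected_component (cells X) x y -> cell u y ->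
    (K u <-> (\bigcup_(w in K) closure (cell w)) y)).
  split=> y u CCy uy; have [u' Xu u'y] := CCX _ CCy;
    rewrite -(cell_uniq uy u'y) {u' u'y} in Xu; split.
  - move=> Ku [w [Xw nKw]]; rewrite closure_cell => -[u' /= u'w u'y].
    apply: nKw; apply: (Kstep u) => //.
    by rewrite (cell_uniq uy u'y) u'w.
  - move=> nD; apply: contrapT => nKu; apply: nD; exists u => //.
    exact: subset_closure.
  - by move=> Ku; exists u => //; exact: subset_closure.
  - move=> [w Kw]; rewrite closure_cell => -[u' /= u'w u'y].
    by apply: (Kstep w) => //; rewrite (cell_uniq uy u'y) u'w orbT.
apply: (component_connected (A := cells X) (x := x)).
- by exists x; split=> //; exists v => //; exact: linked0.
- exists (~` (\bigcup_(w in X `\` K) closure (cell w))).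
    by apply: closed_openC; exact: finite_cells_closed.
  apply/seteqP; split=> y [CCy]; first by move=> [u Ku uy]; split=> //; exact/(openK y u).
  by have [u Xu uy] := CCX _ CCy; split=> //; exists u => //; exact/(openK y u).
- exists (\bigcup_(w in K) closure (cell w)); first exact: finite_cells_closed.
  apply/seteqP; split=> y [CCy].
    by move=> [u Ku uy]; split=> //; exists u => //; exact: subset_closure.
  move=> D; have [u Xu uy] := CCX _ CCy; split=> //; exists u => //.
  exact/(closedK y u).
Qed.

End RegularComplex.

(** * Templates in terms of labels *)

(* The trace of a template on its labels: [le] is incidence, [west] and [east] are
   the cells contained in the hemispheres. *)
Record combi (L : Type) := Combi {
  dim : L -> nat;
  le : rel L;
  tl : L -> L;
  hd : L -> L;
  pN : L;
  pS : L;
  pWE : seq L;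
  pEW : seq L;
  west : set L;
  east : set L
}.

Section Combinatorics.
Variables (L : eqType) (c : combi L).
Implicit Types (e u v : L) (p : seq L).

Fixpoint cdipath u p v : bool :=
  if p is e :: p' then [&& dim c e == 1%N, tl c e == u & cdipath (hd c e) p' v]
  else u == v.

Definition on_path p v := has (le c v) p.

Definition on_meridians v := on_path (pWE c) v || on_path (pEW c) v.

Definition cface_at (H : set L) e f := [/\ dim c f == 2%N, H f & le c e f].

Definition coverlap p : Prop :=
  exists fW fE,
    [/\ unique (cface_at (west c) (head (pN c) p)) fW,
        unique (cface_at (east c) (last (pN c) p)) fE
      & exists2 e, e \in p & le c e fW /\ le c e fE].

Definition off_meridians O v : Prop := v <> O /\ ~~ on_meridians v.

Record combi_template : Prop := {
  ct_orient : forall e, dim c e == 1%N ->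
    tl c e != hd c e /\
    forall v, (le c v e /\ v <> e) <-> (v = tl c e \/ v = hd c e);
  ct_acyclic : forall v p, cdipath v p v -> p = [::];
  ct_source : forall v,
    (dim c v == 0%N /\ forall e, dim c e == 1%N -> hd c e <> v) <-> v = pN c;
  ct_sink : forall v,
    (dim c v == 0%N /\ forall e, dim c e == 1%N -> tl c e <> v) <-> v = pS c;
  ct_WE : cdipath (pN c) (pWE c) (pS c);
  ct_EW : cdipath (pN c) (pEW c) (pS c);
  ct_disjoint : forall v, (on_path (pWE c) v /\ on_path (pEW c) v) <->
    (v = pN c \/ v = pS c);
  ct_ball : exists O, [/\ dim c O = 3%N, (forall v, le c v O),
    west c <> east c &
    forall P : set L,
      (exists2 v, off_meridians O v & P = linked (le c) (off_meridians O) v)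
      <-> P = west c \/ P = east c];
  ct_towards : forall e v, dim c e == 1%N -> west c e -> dim c v == 0%N ->
    le c v e -> on_meridians v -> v <> pN c -> v <> pS c -> v = hd c e;
  ct_away : forall e v, dim c e == 1%N -> east c e -> dim c v == 0%N ->
    le c v e -> on_meridians v -> v <> pN c -> v <> pS c -> v = tl c e;
  ct_overlap_WE : coverlap (pWE c);
  ct_overlap_EW : coverlap (pEW c)
}.

End Combinatorics.

Definition combi_of (d : template_data) : combi (label d) :=
  @Combi (label d) (@cdim d) (@cell_le d) (@etail d) (@ehead d) (poleN d)
    (poleS d) (WE d) (EW d) [set v | in_hemisphere (hemiW d) v]
    [set v | in_hemisphere (hemiE d) v].

Section TemplateCombi.
Variables (R : realType) (d : template_data).
Hypothesis regC : regular_cell_complex R d.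
Let c := combi_of d.

Lemma path_supportE (p : seq (label d)) : @path_support d p = cells (on_path c p).
Proof.
apply/seteqP; split=> [x [e pe]|x [v /hasP[e pe ve] vx]].
  rewrite /= (closure_cell regC) => -[v ve vx]; exists v => //.
  by apply/hasP; exists e.
exists e => //; rewrite (closure_cell regC).
by exists v.
Qed.

Lemma meridiansE : @meridians d = cells (on_meridians c).
Proof.
rewrite /meridians !path_supportE cellsU; congr cells.
by apply/seteqP; split=> v /orP.
Qed.

Lemma sphere_off_meridians (O : label d) :
  (forall v, cell_le v O) ->
  cboundary O `\` @meridians d = cells (off_meridians c O).
Proof.
move=> leO; rewrite meridiansE (cboundaryE regC) (cellsD regC); congr cells.
apply/seteqP; split=> v.
  by move=> [[_ vO] /negP onm]; split.
by move=> [vO /negP onm]; do !split.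
Qed.

Lemma incidentE (u v : label d) : incident u v = cell_le u v :> Prop.
Proof. by rewrite /cell_le asboolE. Qed.

Lemma orientationP (e : label d) : is_edge e ->
  (cboundary e = cell (etail e) `|` cell (ehead e) <->
   forall v, (le c v e /\ v <> e) <-> (v = tl c e \/ v = hd c e)).
Proof.
move=> ee; rewrite -!cells1 cellsU (cboundaryE regC); split.
  by move=> /(cells_inj regC) E v; rewrite -[_ /\ _]/([set u | cell_le u e /\ u <> e] v) E.
by move=> E; congr cells; apply/seteqP; split=> v /E.
Qed.

Lemma carrier_closureP (O : label d) :
  carrier d = closure (cell O) <-> forall v, cell_le v O.
Proof.
rewrite (closure_cell regC) carrierE; split=> [/(cells_inj regC) E v|E].
  by have : [set: label d] v by []; rewrite E.
by congr cells; apply/seteqP; split=> // v _; exact: E.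
Qed.

Lemma face_atE (H : set (ambient d)) (e : label d) :
  face_at H e = cface_at c [set v | in_hemisphere H v] e.
Proof. by apply/funext => f; rewrite /face_at incidentE. Qed.

Lemma overlapE p : @overlap d p = coverlap c p.
Proof.
rewrite /overlap !face_atE /coverlap.
apply/propext; split=> -[fW [fE [uW uE [e ep ee]]]]; exists fW, fE; split=> //;
  by exists e => //; move: ee; rewrite !incidentE.
Qed.

(** The remaining clauses compare unions of cells, so [cells_inj] and [cells_sub] turn them into
    statements on labels once the hemispheres are known to be unions of cells. *)
Lemma template_combi : is_template d R ->
  [/\ combi_template c, hemiW d = cells (west c) & hemiE d = cells (east c)].
Proof.
move=> T.
have [b [dO /carrier_closureP leO WE_neq comp]] := tpl_ball T.
(* A hemisphere is a component of the sphere minus the meridians, and [cells_component] presents it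
   as a union of cells. *)
have hemi_cells H : H = hemiW d \/ H = hemiE d ->
    H = cells [set v | cell v `<=` H].
  move=> /comp [x]; rewrite sphere_off_meridians // => -[v Xv vx] ->.
  rewrite (cells_component regC Xv vx); congr cells.
  by apply/funext => u /=; rewrite (cells_sub regC).
have W_cells : hemiW d = cells (west c) by apply: hemi_cells; left.
have E_cells : hemiE d = cells (east c) by apply: hemi_cells; right.
have orient := tpl_bipolar T.
split=> //; split.
- move=> e ee; have [/(_ e ee)[] + + _ _ _] := orient.
  by move=> ? /(orientationP ee).
- by have [_ ac _ _] := orient.
- by have [_ _ so _] := orient.
- by have [_ _ _ si] := orient.
- exact: tpl_WE T.
- exact: tpl_EW T.
- move=> v; have := tpl_disjoint T.
  rewrite !path_supportE -!cells1 (cellsI regC) cellsU.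
  move=> /(cells_inj regC) E.
  by rewrite -[_ /\ _]/((on_path c (pWE c) `&` on_path c (pEW c)) v) E.
- exists b; split=> //.
    by move=> WE_eq; apply: WE_neq; rewrite W_cells E_cells WE_eq.
  move=> P; split.
    move=> [v Xv ->]; have [x vx] := cell_nonempty regC v.
    have := (comp (connected_component (cells (off_meridians c b)) x)).1.
    rewrite sphere_off_meridians // (cells_component regC Xv vx) W_cells E_cells.
    case; first by exists x; [exists v|rewrite (cells_component regC Xv vx)].
      by move/(cells_inj regC) => ->; left.
    by move/(cells_inj regC) => ->; right.
  move=> PWE; have : cells P = hemiW d \/ cells P = hemiE d.
    by case: PWE => ->; [left|right].
  move=> /comp[x]; rewrite sphere_off_meridians // => -[v Xv vx].
  rewrite (cells_component regC Xv vx) => /(cells_inj regC) ->.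
  by exists v.
- move=> e v ee We vv ve onm vN vS; apply: (tpl_towards T) => //.
    by rewrite incidentE.
  by rewrite meridiansE (cells_sub regC).
- move=> e v ee We vv ve onm vN vS; apply: (tpl_away T) => //.
    by rewrite incidentE.
  by rewrite meridiansE (cells_sub regC).
- by rewrite -overlapE; exact: tpl_overlap_WE T.
- by rewrite -overlapE; exact: tpl_overlap_EW T.
Qed.

(** The two equalities on hemispheres are assumed because [combi_of d] only records which cells a
    hemisphere contains, not that these cells fill it. *)
Lemma combi_template_template :
  combi_template c -> hemiW d = cells (west c) -> hemiE d = cells (east c) ->
  is_template d R.
Proof.
move=> T hW hE.
have [b [dO leO WE_neq comp]] := ct_ball T.
split=> //.
- split.
  + move=> e ee; have [? ?] := ct_orient T ee; split => //.
    by apply/(orientationP ee).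
  + exact: ct_acyclic T.
  + exact: ct_source T.
  + exact: ct_sink T.
- exact: ct_WE T.
- exact: ct_EW T.
- rewrite !path_supportE -!cells1 (cellsI regC) cellsU; congr cells.
  by apply/seteqP; split=> v /(ct_disjoint T).
- exists b; split=> //; first by apply/carrier_closureP.
    by rewrite hW hE => /(cells_inj regC).
  move=> H; rewrite sphere_off_meridians // hW hE; split.
    move=> [x [v Xv vx] ->]; rewrite (cells_component regC Xv vx).
    suff: linked (le c) (off_meridians c b) v = west c \/
          linked (le c) (off_meridians c b) v = east c.
      by case=> <-; [left|right].
    by apply/comp; exists v.
  move=> HWE; have [P HP PWE] : exists2 P, H = cells P & P = west c \/ P = east c.
    by case: HWE => ->; [exists (west c) => //; left|exists (east c) => //; right].
  move/comp: PWE => [v Xv PE]; have [x vx] := cell_nonempty regC v.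
  exists x; first by exists v.
  by rewrite HP PE (cells_component regC Xv vx).
- move=> e v ee We vv; rewrite incidentE meridiansE (cells_sub regC).
  exact: (ct_towards T ee We vv).
- move=> e v ee We vv; rewrite incidentE meridiansE (cells_sub regC).
  exact: (ct_away T ee We vv).
- by rewrite overlapE; exact: ct_overlap_WE T.
- by rewrite overlapE; exact: ct_overlap_EW T.
Qed.

End TemplateCombi.

(** * Transport along isomorphisms *)

Lemma homeomorphism_on_trans (X Y Z : topologicalType) (A : set X) (B : set Y)
    (D : set Z) f h :
  homeomorphism_on A B f -> homeomorphism_on B D h -> homeomorphism_on A D (h \o f).
Proof.
move=> [g [fc gc fA fK]] [k [hc kc hB hK]]; exists (g \o k).
(* Continuity holds only relative to the subspaces, so the composition has to use that the image of
   the first subspace lies in the second. *)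
have comp_within (X' Y' Z' : topologicalType) (A' : set X') (B' : set Y')
    (f' : X' -> Y') (h' : Y' -> Z') : {within A', continuous f'} ->
    {within B', continuous h'} -> f' @` A' `<=` B' ->
    {within A', continuous (h' \o f')}.
  move=> /subspace_continuousP cf /subspace_continuousP ch sub.
  apply/subspace_continuousP => x Ax.
  have Bfx : B' (f' x) by apply: sub; exists x.
  apply: cvg_comp (ch _ Bfx).
  move=> U; rewrite /within /= => /(cf x Ax).
  rewrite /within /= /nbhs /=; apply: filterS => y.
  by move=> h1 A'y; apply: h1 => //; apply: sub; exists y.
have kD : k @` D = B.
  rewrite -hB; apply/seteqP; split=> [_ [_ [y By <-] <-]|y By].
    by rewrite hK.
  by exists (h y); [exists y|rewrite hK].
split.
- by apply: comp_within fc hc _; rewrite fA.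
- by apply: comp_within kc gc _; rewrite kD.
- by rewrite -image_comp fA.
- move=> x Ax /=; rewrite hK ?fK //.
  by rewrite -fA; exists x.
Qed.

Section ComplexIsomorphism.
Variables (R : realType).

Lemma complex_isomorphism_trans (C D E : cell_complex) f g phi psi :
  @complex_isomorphism C D f phi -> @complex_isomorphism D E g psi ->
  @complex_isomorphism C E (g \o f) (psi \o phi).
Proof.
move=> [fh phib fd fc] [gh psib gd gc]; split.
- exact: homeomorphism_on_trans fh gh.
- exact: bij_comp.
- by move=> v /=; rewrite gd fd.
- by move=> v; rewrite -image_comp fc gc.
Qed.

Lemma complex_isomorphism_sym (C D : cell_complex) f phi :
  @complex_isomorphism C D f phi ->
  exists g psi, [/\ @complex_isomorphism D C g psi, cancel phi psi,
    cancel psi phi & forall x, carrier C x -> g (f x) = x].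
Proof.
move=> [[g [fcont gcont fC fK]] [psi phiK psiK] fd fc].
exists g, psi; split=> //; split.
- exists f; split=> //.
    rewrite -fC image_comp; apply/seteqP; split=> [_ [x Cx /= <-]|x Cx].
      by rewrite fK.
    by exists x => //=; exact: fK.
  by move=> y; rewrite -fC => -[x Cx <-]; rewrite fK.
- by exists phi.
- by move=> v; rewrite -{2}(psiK v) fd.
- move=> v; rewrite -{1}(psiK v) -fc image_comp.
  have sub : cell (psi v) `<=` carrier C by move=> x vx; exists (psi v).
  apply/seteqP; split=> [_ [x /[dup] /sub Cx vx /= <-]|x /[dup] /sub Cx vx].
    by rewrite fK.
  by exists x => //=; exact: fK.
Qed.

(** Points of [cell u] are limits of points of [cell v]. Both cells lie in the carrier, where [f] is
    continuous, so the images are limits too. *)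
Lemma complex_isomorphism_le (C D : cell_complex) f phi :
  regular_cell_complex R C ->
  @complex_isomorphism C D f phi ->
  forall u v, cell_le u v -> cell_le (phi u) (phi v).
Proof.
move=> regC [[g [fcont _ _ _]] _ _ fc] u v /asboolP uv; apply/asboolP.
rewrite -!fc => _ [x ux <-]; have clx := uv _ ux.
have Cx : carrier C x by exists u.
move/subspace_continuousP: fcont => /(_ x Cx) fx U /fx.
rewrite /within /= /nbhs /= => /clx [y [vy Uy]].
exists (f y); split; first by exists y.
by apply: Uy; exists v.
Qed.

Lemma complex_isomorphism_leE (C D : cell_complex) f phi :
  regular_cell_complex R C -> regular_cell_complex R D ->
  @complex_isomorphism C D f phi ->
  forall u v, cell_le (phi u) (phi v) = cell_le u v.
Proof.
move=> regC regD iso u v; apply/idP/idP; last exact: complex_isomorphism_le iso _ _.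
have [g [psi [iso' phiK _ _]]] := complex_isomorphism_sym iso.
by move=> /(complex_isomorphism_le regD iso'); rewrite !phiK.
Qed.

Lemma image_cells (C D : cell_complex) f phi :
  @complex_isomorphism C D f phi ->
  forall P : set (label C), f @` cells P = cells (phi @` P).
Proof.
move=> [_ _ _ fc] P; apply/seteqP; split=> [_ [x [v Pv vx] <-]|].
  by exists (phi v); [exists v|rewrite -fc; exists x].
move=> y [_ [v Pv <-]]; rewrite -fc => -[x vx <-].
by exists x => //; exists v.
Qed.

End ComplexIsomorphism.

Lemma combi_template_isomorphism (d d' : template_data)
    (f : ambient d -> ambient d') (phi : label d -> label d') :
  complex_isomorphism f phi ->
  hemiW d = cells (west (combi_of d)) -> hemiE d = cells (east (combi_of d)) ->
  hemiW d' = cells (west (combi_of d')) -> hemiE d' = cells (east (combi_of d')) ->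
  (forall e, is_edge e -> etail (phi e) = phi (etail e)) ->
  (forall e, is_edge e -> ehead (phi e) = phi (ehead e)) ->
  phi (poleN d) = poleN d' -> phi (poleS d) = poleS d' ->
  map phi (WE d) = WE d' -> map phi (EW d) = EW d' ->
  (forall v, west (combi_of d') (phi v) <-> west (combi_of d) v) ->
  (forall v, east (combi_of d') (phi v) <-> east (combi_of d) v) ->
  template_isomorphism f phi.
Proof.
move=> iso dW dE d'W d'E tE hE NE SE WE_E EW_E wE eE; split=> //.
  rewrite dW d'W (image_cells iso); congr cells.
  have [psi phiK psiK] := ci_bij iso.
  apply/seteqP; split=> [_ [v + <-]|v]; first by move/wE.
  by rewrite -(psiK v) => /wE ?; exists (psi v).
rewrite dE d'E (image_cells iso); congr cells.
have [psi phiK psiK] := ci_bij iso.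
apply/seteqP; split=> [_ [v + <-]|v]; first by move/eE.
by rewrite -(psiK v) => /eE ?; exists (psi v).
Qed.

Section CombiMap.
Variables (L L' : eqType) (phi : L -> L') (psi : L' -> L) (c : combi L).
Hypotheses (phiK : cancel phi psi) (psiK : cancel psi phi).

(** Transport of structure along the bijection [phi] with inverse [psi]: predicates and relations
    are pulled back by [psi], end maps are conjugated, and paths are pushed forward. *)
Definition combi_map : combi L' :=
  Combi (dim c \o psi) (fun u v => le c (psi u) (psi v)) (phi \o tl c \o psi)
    (phi \o hd c \o psi) (phi (pN c)) (phi (pS c)) (map phi (pWE c))
    (map phi (pEW c)) (psi @^-1` west c) (psi @^-1` east c).

Let phi_inj := can_inj phiK.
Let psi_inj := can_inj psiK.

Lemma psi_eq u v : (psi u = v) <-> (u = phi v).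
Proof. by split=> [<-|->]. Qed.

Lemma phi_eq u v : (phi u = v) <-> (u = psi v).
Proof. by split=> [<-|->]. Qed.

Lemma cdipath_map u p v :
  cdipath combi_map u p v = cdipath c (psi u) (map psi p) (psi v).
Proof.
elim: p u => [|e p IH] u /=; first by rewrite (inj_eq psi_inj).
by rewrite IH phiK -(inj_eq psi_inj) phiK.
Qed.

Lemma on_path_map p u : on_path combi_map (map phi p) u = on_path c p (psi u).
Proof. by rewrite /on_path has_map; apply: eq_has => e /=; rewrite phiK. Qed.

Lemma on_meridians_map u : on_meridians combi_map u = on_meridians c (psi u).
Proof. by rewrite /on_meridians !on_path_map. Qed.

Lemma off_meridians_map b u :
  off_meridians combi_map (phi b) u <-> off_meridians c b (psi u).
Proof. by rewrite /off_meridians on_meridians_map psi_eq. Qed.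

Lemma linked_map b u w :
  linked (le combi_map) (off_meridians combi_map (phi b)) u w <->
  linked (le c) (off_meridians c b) (psi u) (psi w).
Proof.
split; first elim.
- exact: linked0.
- move=> {}w x _ lw /off_meridians_map offx wx.
  exact: linkedS lw offx wx.
move: {-1}(psi w) (erefl (psi w)) => w' w'E l.
elim: l w w'E => [w /psi_inj ->|{}w' x _ IH offx wx y yE]; first exact: linked0.
apply: (@linkedS _ _ _ _ (phi w')); first exact: IH (phiK w').
  by apply/off_meridians_map; rewrite yE.
by rewrite /= phiK yE.
Qed.

Lemma coverlap_map p : coverlap c p -> coverlap combi_map (map phi p).
Proof.
have uface H e f : unique (cface_at c H e) f ->
    unique (cface_at combi_map (psi @^-1` H) (phi e)) (phi f).
  move=> [[df Hf fe] un]; split; first by split; rewrite /preimage /= ?phiK.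
  move=> f' [df' Hf' fe']; apply/phi_eq; apply: un; split=> //.
  by move: fe'; rewrite /= phiK.
move=> [fW [fE [uW uE [e ep [eW eE]]]]]; exists (phi fW), (phi fE).
have headE : head (phi (pN c)) (map phi p) = phi (head (pN c) p) by case: (p).
split; rewrite /= ?last_map ?headE; [exact: uface|exact: uface|].
exists (phi e); first exact: map_f.
by rewrite !phiK.
Qed.

Lemma combi_map_template : combi_template c -> combi_template combi_map.
Proof.
move=> T; split=> /=.
- move=> e /(ct_orient T)[ne inc]; rewrite (inj_eq phi_inj); split=> // v.
  have := inc (psi v); rewrite !psi_eq psiK => <-.
  by [].
- by move=> v p; rewrite cdipath_map => /(ct_acyclic T); case: p.
- move=> v; rewrite -psi_eq -(ct_source T); split=> -[dv nh]; split=> // e de.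
    by move=> hv; apply: (nh (phi e)); rewrite phiK // hv psiK.
  by move=> /phi_eq; exact: nh.
- move=> v; rewrite -psi_eq -(ct_sink T); split=> -[dv nh]; split=> // e de.
    by move=> hv; apply: (nh (phi e)); rewrite phiK // hv psiK.
  by move=> /phi_eq; exact: nh.
- by rewrite cdipath_map !phiK mapK //; exact: ct_WE T.
- by rewrite cdipath_map !phiK mapK //; exact: ct_EW T.
- by move=> v; rewrite !on_path_map -!psi_eq; exact: (ct_disjoint T (psi v)).
- have [b [db leb neq comp]] := ct_ball T.
  have preimage_inj P Q : psi @^-1` P = psi @^-1` Q -> P = Q.
    move=> E; apply/funext => v; rewrite -(phiK v).
    exact: (congr1 (fun S : set L' => S (phi v)) E).
  have linkedE v : linked (le combi_map) (off_meridians combi_map (phi b)) v =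
      psi @^-1` linked (le c) (off_meridians c b) (psi v).
    by apply/funext => w; apply/propext; exact: linked_map.
  exists (phi b); split=> /=.
  + by rewrite phiK.
  + by move=> v; rewrite phiK.
  + by move=> /preimage_inj.
  + move=> P; have PE : P = psi @^-1` (phi @^-1` P).
      by apply/funext => v; rewrite /preimage /= psiK.
    rewrite PE; split.
      move=> [v /off_meridians_map Xv]; rewrite linkedE => /preimage_inj E.
      have /comp [->|->] : exists2 u, off_meridians c b u &
        phi @^-1` P = linked (le c) (off_meridians c b) u by exists (psi v).
        by left.
      by right.
    move=> PWE; have /comp [u Xu E] : phi @^-1` P = west c \/ phi @^-1` P = east c.
      by case: PWE => /preimage_inj ->; [left|right].
    exists (phi u); first by apply/off_meridians_map; rewrite phiK.
    by rewrite linkedE phiK E.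
- move=> e v de we dv ve; rewrite on_meridians_map -!psi_eq => onm vN vS.
  exact: (ct_towards T de we dv ve onm vN vS).
- move=> e v de we dv ve; rewrite on_meridians_map -!psi_eq => onm vN vS.
  exact: (ct_away T de we dv ve onm vN vS).
- exact: coverlap_map (ct_overlap_WE T).
- exact: coverlap_map (ct_overlap_EW T).
Qed.

End CombiMap.

(** * Balls of gauges *)

Lemma continuous_sumR (X : topologicalType) (R : realType) (I : finType)
    (F : I -> X -> R) :
  (forall i, continuous (F i)) -> continuous (fun x => \sum_i F i x).
Proof. by move=> cF x; apply: cvg_big => [|i _]; [exact: add_continuous|exact: cF]. Qed.

Section Gauge.
Variables (R : realType) (n : nat).
Implicit Types (g : 'rV[R]_n -> R) (x : 'rV[R]_n).

(** A Minkowski functional. Homogeneity concerns nonnegative scalars only, so that a triangle, which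
    is not symmetric about its barycenter, is a unit ball as well. The last clause bounds the unit
    ball and makes [g] positive away from 0. *)
Definition gauge g : Prop :=
  [/\ continuous g,
      (forall (t : R) x, 0 <= t -> g (t *: x) = t * g x)
    & exists2 C, 0 < C & forall x i, `|x ord0 i| <= C * g x].

Lemma gauge0 g : gauge g -> g 0 = 0.
Proof. by move=> [_ gZ _]; rewrite -[X in g X](scale0r 0) gZ // mul0r. Qed.

Lemma rV_neq0 x : x != 0 -> exists i, x ord0 i != 0.
Proof.
move=> x0; apply: contrapT => /forallNP h; case/eqP: x0.
by apply/rowP => i; rewrite mxE; apply/eqP; have /negP := h i; rewrite negbK.
Qed.

Lemma gauge_gt0 g x : gauge g -> x != 0 -> 0 < g x.
Proof.
move=> [_ gZ [C C0 gC]] /rV_neq0 [i xi]; rewrite -(pmulr_rgt0 _ C0).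
by apply: lt_le_trans (gC x i); rewrite normr_gt0.
Qed.

Lemma gauge_ge0 g x : gauge g -> 0 <= g x.
Proof.
move=> gg; have [->|x0] := eqVneq x 0; first by rewrite gauge0.
exact: ltW (gauge_gt0 gg x0).
Qed.

Lemma gauge_l2 : gauge (fun x => Num.sqrt (\sum_i x ord0 i ^+ 2)).
Proof.
have sq_ge0 x : 0 <= \sum_i x ord0 i ^+ 2 by apply: sumr_ge0 => i _; exact: sqr_ge0.
split.
- move=> x; apply: (@continuous_comp _ _ _ _ (@Num.sqrt R)); last exact: sqrt_continuous.
  apply: continuous_sumR => i {}x; apply: continuousM; exact: coord_continuous.
- move=> t x t0; rewrite -{2}(ger0_norm t0) -sqrtr_sqr -sqrtrM ?sqr_ge0 //.
  by congr Num.sqrt; rewrite mulr_sumr; apply: eq_bigr => i _; rewrite mxE exprMn.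
- exists 1 => // x i; rewrite mul1r -sqrtr_sqr ler_sqrt //.
  by rewrite (bigD1 i) //= lerDl; apply: sumr_ge0 => j _; exact: sqr_ge0.
Qed.

(** The radial map sending level sets of [g1] to level sets of [g2]. At 0 the quotient takes the
    default value of division by 0, and the result is still 0. *)
Definition rescale g1 g2 x : 'rV[R]_n := (g1 x / g2 x) *: x.

Lemma gauge_rescale g1 g2 x : gauge g1 -> gauge g2 -> g2 (rescale g1 g2 x) = g1 x.
Proof.
move=> gg1 gg2; have [->|x0] := eqVneq x 0.
  by rewrite /rescale scaler0 !gauge0.
have [_ gZ _] := gg2.
rewrite /rescale gZ ?divr_ge0 ?gauge_ge0 // divfK //.
by rewrite gt_eqF // gauge_gt0.
Qed.

Lemma rescaleK g1 g2 : gauge g1 -> gauge g2 ->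
  cancel (rescale g1 g2) (rescale g2 g1).
Proof.
move=> gg1 gg2 x; have [->|x0] := eqVneq x 0; first by rewrite /rescale !scaler0.
rewrite {1}/rescale gauge_rescale // /rescale scalerA.
have [_ gZ _] := gg1; rewrite gZ ?divr_ge0 ?gauge_ge0 //.
rewrite -[RHS]scale1r; congr (_ *: _); field.
by rewrite !gt_eqF // gauge_gt0.
Qed.

(** Away from 0 the factor is a quotient of continuous functions with nonzero denominator. At 0 each
    coordinate is squeezed between two functions tending to 0. *)
Lemma rescale_continuous g1 g2 : gauge g1 -> gauge g2 -> continuous (rescale g1 g2).
Proof.
move=> gg1 gg2; have [c1 _ _] := gg1; have [c2 _ [C C0 gC]] := gg2.
apply: continuous_rV => i.
have -> : (fun y => rescale g1 g2 y ord0 i) = (fun y => g1 y / g2 y * y ord0 i).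
  by apply/funext => y; rewrite mxE.
move=> x; rewrite /continuous_at.
have [xE|x0] := eqVneq x 0; last first.
  have g2x : {for x, continuous (fun y => (g2 y)^-1)}.
    by apply: continuousV; [rewrite gt_eqF // gauge_gt0|exact: c2].
  have g12x := continuousM (c1 x) g2x.
  exact: continuousM g12x (@coord_continuous _ _ _ ord0 i x).
rewrite [X in _ --> X](_ : _ = 0); last by rewrite xE mxE mulr0.
have g10 : C * g1 y @[y --> x] --> (0 : R).
  have C0E : (0 : R) = C * g1 x by rewrite xE gauge0 // mulr0.
  rewrite [X in _ --> X]C0E.
  exact: (continuousM (@cst_continuous 'rV[R]_n R C x) (c1 x)).
have FF : Filter (nbhs x) by exact: nbhs_filter.
(* The coordinate is at most [C * g2 y] in absolute value, and this [g2 y] cancels the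
   denominator. *)
have bound y : - (C * g1 y) <= g1 y / g2 y * y ord0 i <= C * g1 y.
  rewrite -ler_norml normrM.
  have [->|y0] := eqVneq y 0; first by rewrite mxE normr0 mulr0 gauge0 // mulr0.
  have g2y := gauge_gt0 gg2 y0.
  rewrite ger0_norm ?divr_ge0 ?gauge_ge0 //.
  apply: le_trans (_ : g1 y / g2 y * (C * g2 y) <= _).
    by rewrite ler_wpM2l // divr_ge0 ?gauge_ge0.
  by rewrite mulrCA -mulrA mulVf ?mulr1 ?gt_eqF // lexx.
refine (@squeeze_cvgr _ _ FF R (fun y => - (C * g1 y)) (fun y => C * g1 y) _ _ 0 _ g10).
  exact: nearW.
by rewrite -[X in _ --> X]oppr0; exact: cvgN.
Qed.

Lemma rescale_homeomorphism g1 g2 : gauge g1 -> gauge g2 ->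
  homeomorphism_on [set x | g1 x <= 1] [set x | g2 x <= 1] (rescale g1 g2) /\
  rescale g1 g2 @` [set x | g1 x < 1] = [set x | g2 x < 1].
Proof.
move=> gg1 gg2; split.
  exists (rescale g2 g1); split.
  - by apply: continuous_subspaceT; exact: rescale_continuous.
  - by apply: continuous_subspaceT; exact: rescale_continuous.
  - apply/seteqP; split=> [_ [x /= x1 <-]|x /= x1]; first by rewrite gauge_rescale.
    by exists (rescale g2 g1 x); rewrite ?gauge_rescale //= rescaleK.
  - by move=> x _; rewrite rescaleK.
apply/seteqP; split=> [_ [x /= x1 <-]|x /= x1]; first by rewrite gauge_rescale.
by exists (rescale g2 g1 x); rewrite ?gauge_rescale //= rescaleK.
Qed.

(* The condition on the characteristic map of a cell [A] with closure [B]. *)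
Definition ball_pair (Y : topologicalType) (A B : set Y) : Prop :=
  exists2 f : 'rV[R]_n -> Y, homeomorphism_on (@closed_unit_ball R n) B f
    & f @` @open_unit_ball R n = A.

(** The characteristic map is a radial rescaling of the Euclidean ball to the unit ball of [g],
    followed by [f]. The continuous left inverse [h] makes [f] a homeomorphism onto its image. *)
Lemma gauge_ball_pair (Y : topologicalType) (A B : set Y) g
    (f : 'rV[R]_n -> Y) (h : Y -> 'rV[R]_n) :
  gauge g -> continuous f -> continuous h -> cancel f h ->
  f @` [set x | g x < 1] = A -> f @` [set x | g x <= 1] = B ->
  ball_pair A B.
Proof.
move=> gg cf ch fK fA fB.
have [homeo img] := rescale_homeomorphism gauge_l2 gg.
have sq_ge0 x : 0 <= \sum_i x ord0 i ^+ 2 by apply: sumr_ge0 => i _; exact: sqr_ge0.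
have openE : @open_unit_ball R n = [set x | Num.sqrt (\sum_i x ord0 i ^+ 2) < 1].
  by apply/funext => x /=; rewrite -[X in _ < X]sqrtr1 ltr_sqrt.
have closedE : @closed_unit_ball R n = [set x | Num.sqrt (\sum_i x ord0 i ^+ 2) <= 1].
  by apply/funext => x /=; rewrite -[X in _ <= X]sqrtr1 ler_sqrt.
exists (f \o rescale (fun x => Num.sqrt (\sum_i x ord0 i ^+ 2)) g).
  rewrite closedE; apply: homeomorphism_on_trans homeo _.
  exists h; split=> //; exact: continuous_subspaceT.
by rewrite openE -image_comp img.
Qed.

End Gauge.

(** * The octahedron *)

(* Sign vectors, as a type in which Boolean checks evaluate. *)
Definition sign3 : Type := (option bool * option bool * option bool)%type.
HB.instance Definition _ := Finite.on sign3.

Definition coord (k : sign3) (i : nat) : option bool :=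
  match i with 0 => k.1.1 | 1 => k.1.2 | _ => k.2 end.

Definition center : sign3 := (None, None, None).

Definition nnz (k : sign3) : nat := (k.1.1 != None) + (k.1.2 != None) + (k.2 != None).

Definition sdim (k : sign3) : nat := if nnz k is n.+1 then n else 3.

Definition sign_le (a b : option bool) : bool :=
  if a is Some x then if b is Some y then Bool.eqb x y else false else true.

(** The zero vector is the top element although all its signs vanish, hence the two special cases.
    Nested conditionals let evaluation stop at the first failure. *)
Definition sle (w k : sign3) : bool :=
  match k, w with
  | (None, None, None), _ => true
  | _, (None, None, None) => false
  | (a, b, c), (a', b', c') =>
      if sign_le a' a then if sign_le b' b then sign_le c' c else false else false
  end.

Definition all_signs : seq sign3 :=
  [seq (x, c) | x <- [seq (a, b) | a <- [:: None; Some true; Some false],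
                                  b <- [:: None; Some true; Some false]],
                c <- [:: None; Some true; Some false]].

Lemma mem_all_signs k : k \in all_signs.
Proof. by case: k => [[[[]|] [[]|]] [[]|]]; vm_compute. Qed.

Lemma forall_sign3 (P : sign3 -> bool) : all P all_signs -> forall k, P k.
Proof. by move=> /allP h k; apply: h; exact: mem_all_signs. Qed.

Definition ffun_of_sign3 (k : sign3) : {ffun 'I_3 -> option bool} :=
  [ffun i : 'I_3 => coord k i].

Definition sign3_of_ffun (s : {ffun 'I_3 -> option bool}) : sign3 :=
  (s ord0, s (inord 1), s (inord 2)).

Lemma ffun_of_sign3K : cancel ffun_of_sign3 sign3_of_ffun.
Proof.
by move=> [[a b] c]; rewrite /sign3_of_ffun !ffunE /= !inordK.
Qed.

Lemma sign3_of_ffunK : cancel sign3_of_ffun ffun_of_sign3.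
Proof.
move=> s; apply/ffunP => i; rewrite ffunE /=.
by case: i => [[|[|[|//]]] lti]; congr (s _); apply/val_inj; rewrite /= ?inordK.
Qed.

Section Octahedron.
Variable R : realType.
Implicit Types (k w : sign3) (x : 'rV[R]_3).

Definition l1norm x : R := \sum_(i < 3) `|x ord0 i|.

Definition octa_cell k : set 'rV[R]_3 :=
  if k == center then [set x | l1norm x < 1]
  else [set x | l1norm x = 1 /\ forall i : 'I_3, Num.sg (x ord0 i) = sign_val R (coord k i)].

Definition octa : cell_complex := @CellComplex 'rV[R]_3 sign3 sdim octa_cell.

Lemma sdimE k : octahedron_cdim (ffun_of_sign3 k) = sdim k.
Proof.
rewrite /octahedron_cdim /sdim; suff -> : #|[pred i | ffun_of_sign3 k i != None]| = nnz k by [].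
rewrite -sum1_card big_mkcond /= !big_ord_recl big_ord0 /= !inE !ffunE /= /nnz.
by case: k => [[[[]|] [[]|]] [[]|]].
Qed.

Lemma octa_cellE k : @octahedron_cell R (ffun_of_sign3 k) = octa_cell k.
Proof.
rewrite /octahedron_cell /octa_cell.
have -> : [forall i, ffun_of_sign3 k i == None] = (k == center).
  apply/forallP/eqP => [h|-> i]; last by rewrite ffunE; case: i => [[|[|[|]]]].
  by rewrite -(ffun_of_sign3K k) /sign3_of_ffun; do 3!rewrite (eqP (h _)).
case: ifP => // _; apply/seteqP; split=> x [x1 sx]; split=> // i.
  by rewrite sx ffunE.
by rewrite sx ffunE.
Qed.

Lemma octa_solid_octahedron :
  @complex_isomorphism octa (solid_octahedron R) id ffun_of_sign3.
Proof.
split.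
- exists id; split=> //.
  + by apply: continuous_subspaceT => y; exact: cvg_id.
  + by apply: continuous_subspaceT => y; exact: cvg_id.
  + rewrite image_id; apply/seteqP; split=> x [k _].
      by exists (ffun_of_sign3 k) => //=; rewrite octa_cellE.
    by exists (sign3_of_ffun k) => //=; rewrite -octa_cellE sign3_of_ffunK.
- by exists sign3_of_ffun; [exact: ffun_of_sign3K|exact: sign3_of_ffunK].
- exact: sdimE.
- by move=> k; rewrite image_id /= octa_cellE.
Qed.

Lemma l1norm_continuous : continuous l1norm.
Proof.
apply: continuous_sumR => i x; apply: continuous_comp; first exact: coord_continuous.
exact: norm_continuous.
Qed.

Lemma sign_val_inj : injective (sign_val R).
Proof.
have n11 : (1 : R) <> -1 by move/eqP; rewrite -subr_eq0 opprK paddr_eq0 // oner_eq0.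
case=> [[]|] [[]|] //= /eqP; rewrite ?oner_eq0 ?oppr_eq0 ?oner_eq0 //;
  by rewrite 1?eq_sym ?oner_eq0 ?oppr_eq0 ?oner_eq0 // => /eqP /n11.
Qed.

Definition sign_of (t : R) : option bool := if t == 0 then None else Some (0 < t).

Lemma sign_ofP t : sign_val R (sign_of t) = Num.sg t.
Proof.
rewrite /sign_of; have [t0|t0|->] := ltrgtP t 0;
  by rewrite /= ?sgr0 ?(gtr0_sg t0) ?(ltr0_sg t0).
Qed.

Definition pattern x : sign3 :=
  (sign_of (x ord0 ord0), sign_of (x ord0 (inord 1)), sign_of (x ord0 (inord 2))).

Lemma coord_pattern x (i : 'I_3) : coord (pattern x) i = sign_of (x ord0 i).
Proof.
by case: i => [[|[|[|//]]] lti] /=; congr (sign_of (x ord0 _)); apply/val_inj; rewrite /= ?inordK.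
Qed.

Lemma coord_inj k w : (forall i : 'I_3, coord k i = coord w i) -> k = w.
Proof.
case: k w => [[a b] c] [[a' b'] c'] h.
have /= -> := h ord0; have /= := h (inord 1); have /= := h (inord 2).
by rewrite !inordK //= => -> ->.
Qed.

(** The boundary cells are the fibers of [pattern] on the unit sphere of the l1 norm, which yields
    their disjointness at once. *)
Lemma octa_cell_pattern k x : k != center ->
  octa_cell k x <-> l1norm x = 1 /\ k = pattern x.
Proof.
move=> /negPf k0; rewrite /octa_cell k0 /=; split=> -[x1 sx]; split=> //.
  by apply: coord_inj => i; apply: sign_val_inj; rewrite -sx coord_pattern sign_ofP.
by move=> i; rewrite sx coord_pattern sign_ofP.
Qed.

Lemma l1norm_ge0 x : 0 <= l1norm x.
Proof. by apply: sumr_ge0. Qed.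

Lemma pattern_center x : pattern x = center -> l1norm x = 0.
Proof.
move=> E; apply: big1 => i _; have := sign_ofP (x ord0 i).
rewrite -coord_pattern E; case: i => [[|[|[|//]]] lti] /= /esym /eqP;
  by rewrite sgr_eq0 => /eqP ->; rewrite normr0.
Qed.

Lemma pattern_neq_center x : l1norm x = 1 -> pattern x != center.
Proof. by move=> x1; apply/eqP => /pattern_center /eqP; rewrite x1 oner_eq0. Qed.

Lemma octa_cell_uniq k w x : octa_cell k x -> octa_cell w x -> k = w.
Proof.
have c x1 : octa_cell center x1 = (l1norm x1 < 1) :> Prop by rewrite /octa_cell eqxx.
have [->|k0] := eqVneq k center; have [-> //|w0] := eqVneq w center.
- by rewrite c => + /(octa_cell_pattern _ w0)[x1]; rewrite x1 ltxx.
- by rewrite c => /(octa_cell_pattern _ k0)[x1]; rewrite x1 ltxx.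
by move=> /(octa_cell_pattern _ k0)[_ ->] /(octa_cell_pattern _ w0)[_ ->].
Qed.

(** The equation on a coordinate is the closed form of a sign condition: the coordinate is zero or
    has the given sign, and it is zero when the given sign is. *)
Definition closed_octa_cell k : set 'rV[R]_3 :=
  if k == center then [set x | l1norm x <= 1]
  else [set x | l1norm x = 1 /\
                forall i : 'I_3, sign_val R (coord k i) * `|x ord0 i| = x ord0 i].

Lemma sleP w k : reflect (k = center \/ (w != center /\
    forall i : 'I_3, coord w i = None \/ coord w i = coord k i)) (sle w k).
Proof.
have sign_leP a b : reflect (a = None \/ a = b) (sign_le a b).
  by case: a b => [[]|] [[]|]; constructor; try (by left); try (by right); case.
have sleE : sle w k = (k == center) || (w != center) &&
    [&& sign_le w.1.1 k.1.1, sign_le w.1.2 k.1.2 & sign_le w.2 k.2].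
  by case: w => [[[[]|] [[]|]] [[]|]]; case: k => [[[[]|] [[]|]] [[]|]].
rewrite sleE; apply: (iffP orP) => [[/eqP|/andP[w0 /and3P[h0 h1 h2]]]|[->|[w0 h]]].
- by left.
- right; split=> // i; apply/sign_leP; by case: i => [[|[|[|]]]].
- by left.
right; rewrite w0 /=.
by have /sign_leP /= -> := h ord0; have /sign_leP /= := h (inord 1);
  have /sign_leP /= := h (inord 2); rewrite !inordK //= => -> ->.
Qed.

Lemma sg_sign_val s (t : R) : (Num.sg t = sign_val R s) -> sign_val R s * `|t| = t.
Proof. by move=> <-; rewrite -numEsg. Qed.

Lemma closed_octa_cellE k :
  closed_octa_cell k = \bigcup_(w in [set w | sle w k]) octa_cell w.
Proof.
rewrite /closed_octa_cell; have [->|k0] := eqVneq k center.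
  apply/seteqP; split=> [x /=|x [w _]].
    rewrite le_eqVlt => /orP[/eqP x1|x1].
      exists (pattern x) => //=.
      by apply/octa_cell_pattern => //; exact: pattern_neq_center.
    by exists center => //; rewrite /octa_cell eqxx.
  have [->|w0] := eqVneq w center; first by rewrite /octa_cell eqxx => /ltW.
  by move=> /(octa_cell_pattern _ w0)[x1 _]; rewrite /= x1.
apply/seteqP; split=> [x [x1 sx]|x [w /sleP[/eqP|[w0 wk]]]].
- exists (pattern x).
    apply/sleP; right; split; first exact: pattern_neq_center.
    move=> i; rewrite coord_pattern /sign_of; case: eqP => [|xi]; first by left.
    right; apply: sign_val_inj; have := sign_ofP (x ord0 i).
    rewrite /sign_of; case: eqP => // _ ->.
    have axi : `|x ord0 i| != 0 by rewrite normr_eq0; apply/eqP.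
    by apply: (mulIf axi); rewrite -numEsg sx.
  by apply/octa_cell_pattern => //; exact: pattern_neq_center.
- by rewrite (negPf k0).
- rewrite /octa_cell (negPf w0) => -[x1 sx]; split=> // i.
  have := sx i; have [wi|<-] := wk i; last exact: sg_sign_val.
  by rewrite wi => /eqP; rewrite sgr_eq0 => /eqP ->; rewrite normr0 mulr0.
Qed.

Lemma closed_fiber (f : 'rV[R]_3 -> R) c : continuous f -> closed [set x | f x = c].
Proof.
by move=> cf; apply: (@preimage_closed _ _ f [set y | y = c]) => [x _|];
  [exact: cf|exact: closed_eq].
Qed.

Lemma closed_octa_cell_closed k : closed (closed_octa_cell k).
Proof.
rewrite /closed_octa_cell; case: ifP => _.
  apply: (@preimage_closed _ _ l1norm [set y | y <= 1]) => [x _|];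
    [exact: l1norm_continuous|exact: closed_le].
have -> : [set x | l1norm x = 1 /\
    forall i : 'I_3, sign_val R (coord k i) * `|x ord0 i| = x ord0 i] =
  [set x | l1norm x = 1] `&` \bigcap_(i : 'I_3)
     [set x | sign_val R (coord k i) * `|x ord0 i| - x ord0 i = 0].
  apply/seteqP; split=> x [x1 sx]; split=> // i.
    by move=> _ /=; rewrite sx subrr.
  by apply/eqP; rewrite -subr_eq0; apply/eqP; exact: sx.
apply: closedI; first by apply: closed_fiber; exact: l1norm_continuous.
apply: closed_bigI => i _; apply: closed_fiber => x.
have ci := @coord_continuous _ _ _ ord0 i x.
have cn := continuous_comp ci (@norm_continuous _ _ _).
exact: (continuousB (continuousM (@cst_continuous _ R (sign_val R (coord k i)) x) cn) ci).
Qed.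

Definition barycenter k : 'rV[R]_3 := \row_i (sign_val R (coord k i) / (nnz k)%:R).

Lemma octa_cell_barycenter k : octa_cell k (barycenter k).
Proof.
have [->|k0] := eqVneq k center.
  rewrite /octa_cell eqxx /l1norm /= big1 ?ltr01 // => i _.
  by rewrite mxE /=; case: i => [[|[|[|]]]] //= _; rewrite mul0r normr0.
have n0 : (0 : R) < (nnz k)%:R.
  by rewrite ltr0n; move: k0; case: (k) => [[[[]|] [[]|]] [[]|]].
rewrite /octa_cell (negPf k0); split=> [|i]; last first.
  rewrite mxE sgrM [Num.sg _^-1]gtr0_sg ?invr_gt0 // mulr1.
  by case: (coord _ _) => [[]|] /=; rewrite ?sgrN ?sgr1 ?sgr0.
transitivity (\sum_(i < 3) ((coord k i != None)%:R / (nnz k)%:R : R)).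
  apply: eq_bigr => i _; rewrite mxE normrM normfV (gtr0_norm n0).
  by congr (_ / _); case: (coord _ _) => [[]|] /=; rewrite ?normrN ?normr1 ?normr0.
rewrite -mulr_suml !big_ord_recl big_ord0 /= addr0 -!natrD.
by rewrite /nnz addnA divff // gt_eqF.
Qed.

(* With [b] the barycenter and [t] tending to [0], this exhibits [x] as a limit of
   points of the open cell. *)
Lemma octa_cell_segment k x b t : closed_octa_cell k x -> octa_cell k b ->
  0 < t < 1 -> octa_cell k (x + t *: (b - x)).
Proof.
rewrite /closed_octa_cell /octa_cell => + + /andP[t0 t1]; case: ifP => _ /=.
  move=> x1 b1; apply: le_lt_trans (_ : (1 - t) * l1norm x + t * l1norm b < 1).
    rewrite /l1norm !mulr_sumr -big_split /=; apply: ler_sum => i _.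
    have -> : (x + t *: (b - x)) ord0 i = (1 - t) * x ord0 i + t * b ord0 i.
      by rewrite !mxE; ring.
    apply: le_trans (ler_normD _ _) _.
    by rewrite !normrM (gtr0_norm t0) ger0_norm // subr_ge0 ltW.
  have := l1norm_ge0 x; have := l1norm_ge0 b; nra.
move=> [x1 sx] [b1 sb].
have sp i : Num.sg ((x + t *: (b - x)) ord0 i) = sign_val R (coord k i).
  rewrite !mxE; have := sx i; have := sb i; have := sg_sign_val (sb i).
  case: (coord k i) => [[]|] /=.
  - move=> _ /eqP; rewrite sgr_cp0 mul1r => bi xi; apply: gtr0_sg.
    have : 0 <= x ord0 i by rewrite -xi.
    nra.
  - move=> _ /eqP; rewrite sgr_cp0 mulN1r => bi xi; apply: ltr0_sg.
    have : x ord0 i <= 0 by rewrite -xi oppr_le0.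
    nra.
  - rewrite !mul0r => <- _ <-; by rewrite subrr mulr0 addr0 sgr0.
split=> //.
(* On a closed face the l1 norm is a linear form, so its value 1 is kept along the segment. *)
have normE (y : 'rV[R]_3) : (forall i : 'I_3, sign_val R (coord k i) * `|y ord0 i| = y ord0 i) ->
    l1norm y = \sum_(i < 3) sign_val R (coord k i) * y ord0 i.
  move=> sy; apply: eq_bigr => i _; have := sy i.
  case: (coord k i) => [[]|] /=; first by rewrite !mul1r.
    by rewrite !mulN1r => <-; rewrite opprK normrN normr_id.
  by rewrite !mul0r => <-; rewrite normr0.
rewrite (normE _ (fun i => sg_sign_val (sp i))).
move: x1 b1; rewrite (normE _ sx) (normE _ (fun i => sg_sign_val (sb i))).
move=> x1 b1.
transitivity ((1 - t) * (\sum_(i < 3) sign_val R (coord k i) * x ord0 i) +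
              t * (\sum_(i < 3) sign_val R (coord k i) * b ord0 i)).
  by rewrite !mulr_sumr -big_split /=; apply: eq_bigr => i _; rewrite !mxE; ring.
by rewrite x1 b1; ring.
Qed.

(** One inclusion holds because the right-hand side is closed. For the other, each of its points is
    approached along the segment from the barycenter. *)
Lemma closure_octa_cell k : closure (octa_cell k) = closed_octa_cell k.
Proof.
apply/seteqP; split.
  rewrite [X in _ `<=` X](iffLR (closure_id _) (@closed_octa_cell_closed k)).
  apply: closureS; rewrite closed_octa_cellE => x kx; exists k => //.
  by apply/sleP; have [->|k0] := eqVneq k center; [left|right; split=> //; right].
move=> x cx U Ux.
pose p (t : R) := x + t *: (barycenter k - x).
have pc : continuous p.
  apply: continuous_rV => i.
  have -> : (fun t => p t ord0 i) =
      (fun t => x ord0 i + t * (barycenter k ord0 i - x ord0 i)).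
    by apply/funext => t; rewrite !mxE.
  move=> t; apply: cvgD; first exact: cvg_cst.
  by apply: cvgM; [exact: cvg_id|exact: cvg_cst].
have p0 : p 0 = x by rewrite /p scale0r addr0.
have : \forall t \near (0 : R)^'+, U (p t).
  by apply: (cvg_at_right_filter (pc 0)); rewrite p0.
move=> near_U.
have near_01 : \forall t \near (0 : R)^'+, 0 < t < 1.
  apply: filterS2 (nbhs_right_gt (0 : R)) (nbhs_right_lt (@ltr01 R)).
  by move=> t t0 t1; apply/andP.
have FF : ProperFilter ((0 : R)^'+) by exact: at_right_proper_filter.
have [t [Upt t01]] := @filter_ex _ _ FF _ (filterI near_U near_01).
exists (p t); split=> //; apply: octa_cell_segment => //.
exact: octa_cell_barycenter.
Qed.

End Octahedron.

(** * Symmetries of the octahedron *)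

Definition gen (n : nat) (k : sign3) : sign3 :=
  let: (a, b, c) := k in
  match n with
  | 0 => (b, a, c)
  | 1 => (a, c, b)
  | 2 => (omap negb a, b, c)
  | 3 => (a, omap negb b, c)
  | _ => (a, b, omap negb c)
  end.

(** With [gen_flip], this describes the generator [gen n] coordinatewise: coordinate [i] of the
    image is coordinate [gen_index n i] of the argument, negated if [gen_flip n i]. The same formula
    then acts on points. *)
Definition gen_index (n : nat) (i : 'I_3) : 'I_3 :=
  match n, val i with
  | 0, 0 => inord 1 | 0, 1 => inord 0
  | 1, 1 => inord 2 | 1, 2 => inord 1
  | _, _ => i
  end.

Definition gen_flip (n : nat) (i : 'I_3) : bool :=
  match n, val i with
  | 2, 0 | 3, 1 => true
  | 0, _ | 1, _ | 2, _ | 3, _ => false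
  | _, 2 => true
  | _, _ => false
  end.

Lemma gen_index_involutive n : involutive (gen_index n).
Proof.
move=> [[|[|[|//]]] lti]; case: n => [|[|n]]; rewrite /gen_index /= ?inordK //=;
  by apply/val_inj; rewrite /= ?inordK.
Qed.

Lemma gen_flip_index n i : gen_flip n (gen_index n i) = gen_flip n i.
Proof.
by case: i => [[|[|[|//]]] lti]; case: n => [|[|[|[|n]]]];
  rewrite /gen_index /gen_flip /= ?inordK.
Qed.

Lemma gen_involutive n : involutive (gen n).
Proof.
by case: n => [|[|[|[|n]]]] [[a b] c] //=; case: a b c => [[]|] [[]|] [[]|].
Qed.

Lemma coord_gen n k (i : 'I_3) :
  coord (gen n k) i = let s := coord k (gen_index n i) in
                      if gen_flip n i then omap negb s else s.
Proof.
by case: i k => [[|[|[|//]]] lti] [[a b] c]; case: n => [|[|[|[|n]]]];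
  rewrite /gen_index /gen_flip /= ?inordK.
Qed.

Lemma sdim_gen n k : sdim (gen n k) = sdim k.
Proof.
by case: n => [|[|[|[|n]]]]; case: k => [[[[]|] [[]|]] [[]|]].
Qed.

Section Symmetry.
Variable R : realType.
Implicit Types (k : sign3) (x : 'rV[R]_3).

Definition gen_map n x : 'rV[R]_3 :=
  \row_i ((-1) ^+ gen_flip n i * x ord0 (gen_index n i)).

Lemma gen_map_involutive n : involutive (gen_map n).
Proof.
move=> x; apply/rowP => i; rewrite !mxE gen_flip_index gen_index_involutive.
by rewrite mulrA -signr_addb addbb mul1r.
Qed.

Lemma gen_map_continuous n : continuous (gen_map n).
Proof.
apply: continuous_rV => i.
have -> : (fun x => gen_map n x ord0 i) =
    (fun x => (-1) ^+ gen_flip n i * x ord0 (gen_index n i)).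
  by apply/funext => x; rewrite mxE.
move=> x; apply: (continuousM (@cst_continuous _ R _ x)).
exact: coord_continuous.
Qed.

Lemma l1norm_gen_map n x : l1norm (gen_map n x) = l1norm x.
Proof.
rewrite /l1norm [RHS](reindex_inj (inv_inj (gen_index_involutive n))).
by apply: eq_bigr => i _; rewrite mxE normrM normr_sign mul1r.
Qed.

Lemma gen_center n k : (gen n k == center) = (k == center).
Proof. by case: n => [|[|[|[|n]]]]; case: k => [[[[]|] [[]|]] [[]|]]. Qed.

Lemma gen_map_cell_sub n k : gen_map n @` @octa_cell R k `<=` @octa_cell R (gen n k).
Proof.
move=> _ [x + <-]; rewrite /octa_cell gen_center; case: ifP => _ /=.
  by rewrite l1norm_gen_map.
rewrite l1norm_gen_map => -[x1 sx]; split=> // i.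
rewrite mxE sgrM sx coord_gen.
case: (gen_flip n i); rewrite ?expr1 ?expr0 ?sgrN sgr1 ?mul1r //=.
by case: (coord _ _) => [[]|] /=; rewrite ?mulN1r ?opprK ?oppr0.
Qed.

(** The inclusion already proved, applied to [gen n k], gives the reverse one because generators are
    involutions. *)
Lemma gen_map_cell n k : gen_map n @` @octa_cell R k = @octa_cell R (gen n k).
Proof.
apply/seteqP; split; first exact: gen_map_cell_sub.
move=> x kx; exists (gen_map n x); last exact: gen_map_involutive.
by rewrite -[k](gen_involutive n); apply: gen_map_cell_sub; exists x.
Qed.

Lemma involution_homeomorphism (X : topologicalType) (f : X -> X) (A : set X) :
  continuous f -> involutive f -> homeomorphism_on A (f @` A) f.
Proof.
move=> cf fK; exists f; split=> //; first exact: continuous_subspaceT.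
  exact: continuous_subspaceT.
Qed.

Lemma gen_map_isomorphism n :
  @complex_isomorphism (octa R) (octa R) (gen_map n) (gen n).
Proof.
split.
- have : gen_map n @` carrier (octa R) = carrier (octa R).
    apply/seteqP; split=> [_ [x [k _ kx] <-]|x [k _ kx]].
      by exists (gen n k) => //; rewrite /= -gen_map_cell; exists x.
    exists (gen_map n x); last exact: gen_map_involutive.
    by exists (gen n k) => //; rewrite /= -gen_map_cell; exists x.
  move=> {2}<-; apply: involution_homeomorphism.
    exact: gen_map_continuous.
  exact: gen_map_involutive.
- by exists (gen n); exact: gen_involutive.
- exact: sdim_gen.
- exact: gen_map_cell.
Qed.

Lemma image_closure_involution (X : topologicalType) (f : X -> X) (A : set X) :
  continuous f -> involutive f -> closure (f @` A) = f @` closure A.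
Proof.
move=> cf fK.
have sub B : f @` closure B `<=` closure (f @` B).
  move=> _ [x clx <-] U /cf /clx [y [By Uy]]; exists (f y); split=> //.
apply/seteqP; split; last exact: sub.
move=> x clx; exists (f x); last exact: fK.
have ffA : f @` (f @` A) = A.
  apply/seteqP; split=> [_ [_ [y Ay <-] <-]|y Ay]; first by rewrite fK.
  by exists (f y); [exists y|exact: fK].
by rewrite -ffA; apply: sub; exists x.
Qed.

(** The last letter of a word acts first. *)
Definition gens (s : seq nat) (k : sign3) : sign3 := foldr gen k s.
Definition gens_map (s : seq nat) x : 'rV[R]_3 := foldr gen_map x s.

Lemma gens_map_isomorphism s :
  @complex_isomorphism (octa R) (octa R) (gens_map s) (gens s).
Proof.
elim: s => [|n s IH]; last exact: complex_isomorphism_trans IH (gen_map_isomorphism n).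
split=> //; last by move=> k; rewrite image_id.
  exists id; split=> //; last exact: image_id.
    by apply: continuous_subspaceT => x; exact: cvg_id.
  by apply: continuous_subspaceT => x; exact: cvg_id.
by exists id.
Qed.

Lemma gen_ball_pair m n k :
  @ball_pair R m _ (@octa_cell R k) (@closed_octa_cell R k) ->
  @ball_pair R m _ (@octa_cell R (gen n k)) (@closed_octa_cell R (gen n k)).
Proof.
move=> [f fh fo].
rewrite -!closure_octa_cell -gen_map_cell in fh *.
rewrite image_closure_involution; [|exact: gen_map_continuous|exact: gen_map_involutive].
exists (gen_map n \o f); last by rewrite -image_comp fo.
apply: homeomorphism_on_trans fh _; apply: involution_homeomorphism.
  exact: gen_map_continuous.
exact: gen_map_involutive.
Qed.

Lemma gens_ball_pair m s k :
  @ball_pair R m _ (@octa_cell R k) (@closed_octa_cell R k) ->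
  @ball_pair R m _ (@octa_cell R (gens s k)) (@closed_octa_cell R (gens s k)).
Proof. by move=> h; elim: s => [|n s IH] //=; exact: gen_ball_pair. Qed.

End Symmetry.

(** * Characteristic maps of one cell in each dimension *)

Section RegularOctahedron.
Variable R : realType.
Implicit Types (k : sign3) (x : 'rV[R]_3).

Let i0 : 'I_3 := Ordinal (isT : 0 < 3)%N.
Let i1 : 'I_3 := Ordinal (isT : 1 < 3)%N.
Let i2 : 'I_3 := Ordinal (isT : 2 < 3)%N.

Lemma forall_ord3 (P : 'I_3 -> Prop) : (forall i, P i) <-> [/\ P i0, P i1 & P i2].
Proof.
split=> [h|[h0 h1 h2] i]; first by split.
by case: i => [[|[|[|//]]] lti]; [have -> : Ordinal lti = i0|have -> : Ordinal lti = i1|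
  have -> : Ordinal lti = i2] => //; apply/val_inj.
Qed.

Lemma l1normE x : l1norm x = `|x ord0 i0| + `|x ord0 i1| + `|x ord0 i2|.
Proof.
rewrite /l1norm !big_ord_recl big_ord0 addr0 addrA.
by congr (`|x _ _| + `|x _ _| + `|x _ _|); apply/val_inj.
Qed.

Definition row3 (a b c : R) : 'rV[R]_3 := \row_i nth 0 [:: a; b; c] i.

Lemma row3_continuous (X : topologicalType) (a b c : X -> R) :
  continuous a -> continuous b -> continuous c ->
  continuous (fun y => row3 (a y) (b y) (c y)).
Proof.
move=> ca cb cc; apply: continuous_rV; apply/forall_ord3; split.
- by have -> : (fun y => row3 (a y) (b y) (c y) ord0 i0) = a by apply/funext => y; rewrite mxE.
- by have -> : (fun y => row3 (a y) (b y) (c y) ord0 i1) = b by apply/funext => y; rewrite mxE.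
- by have -> : (fun y => row3 (a y) (b y) (c y) ord0 i2) = c by apply/funext => y; rewrite mxE.
Qed.

Lemma gauge_l1norm : gauge (@l1norm R).
Proof.
split; first exact: l1norm_continuous.
- move=> t x t0; rewrite /l1norm mulr_sumr; apply: eq_bigr => i _.
  by rewrite mxE normrM (ger0_norm t0).
- exists 1 => // x i; rewrite mul1r /l1norm (bigD1 i) //= lerDl.
  exact: sumr_ge0.
Qed.

Lemma ball_pair_center : @ball_pair R 3 _ (@octa_cell R center) (@closed_octa_cell R center).
Proof.
apply: (@gauge_ball_pair R 3 _ _ _ (@l1norm R) id id) => //.
- exact: gauge_l1norm.
- by move=> x; exact: cvg_id.
- by move=> x; exact: cvg_id.
- by rewrite image_id /octa_cell eqxx.
- by rewrite image_id /closed_octa_cell eqxx.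
Qed.

Lemma octa_cellE3 k x : k != center -> octa_cell k x <->
  `|x ord0 i0| + `|x ord0 i1| + `|x ord0 i2| = 1 /\
  [/\ Num.sg (x ord0 i0) = sign_val R (coord k 0),
      Num.sg (x ord0 i1) = sign_val R (coord k 1) &
      Num.sg (x ord0 i2) = sign_val R (coord k 2)].
Proof.
move=> /negPf k0; rewrite /octa_cell k0 /= -l1normE.
have P := forall_ord3 (fun i => Num.sg (x ord0 i) = sign_val R (coord k i)).
by split=> -[? ?]; split=> //; exact/P.
Qed.

Lemma closed_octa_cellE3 k x : k != center -> closed_octa_cell k x <->
  `|x ord0 i0| + `|x ord0 i1| + `|x ord0 i2| = 1 /\
  [/\ sign_val R (coord k 0) * `|x ord0 i0| = x ord0 i0,
      sign_val R (coord k 1) * `|x ord0 i1| = x ord0 i1 &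
      sign_val R (coord k 2) * `|x ord0 i2| = x ord0 i2].
Proof.
move=> /negPf k0; rewrite /closed_octa_cell k0 /= -l1normE.
have P := forall_ord3 (fun i =>
  sign_val R (coord k i) * `|x ord0 i| = x ord0 i).
by split=> -[? ?]; split=> //; exact/P.
Qed.

Lemma row3_eq x a b c : x = row3 a b c <-> [/\ x ord0 i0 = a, x ord0 i1 = b & x ord0 i2 = c].
Proof.
split=> [->|[<- <- <-]]; first by rewrite !mxE.
by apply/rowP; apply/forall_ord3; rewrite !mxE.
Qed.

Lemma sg1P (t : R) : Num.sg t = 1 <-> 0 < t.
Proof. by split=> [/eqP|/gtr0_sg //]; rewrite sgr_cp0. Qed.

Lemma pos_normP (t : R) : 1 * `|t| = t <-> 0 <= t.
Proof. by rewrite mul1r; split=> [<-|/ger0_norm]. Qed.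

Definition vertex_sign : sign3 := (Some true, None, None).
Definition edge_sign : sign3 := (Some true, Some true, None).
Definition face_sign : sign3 := (Some true, Some true, Some true).

(** In dimension 0 the zero function is a gauge, and its open and closed unit balls are both the
    single point. *)
Lemma ball_pair_vertex :
  @ball_pair R 0 _ (@octa_cell R vertex_sign) (@closed_octa_cell R vertex_sign).
Proof.
pose f (t : 'rV[R]_0) := row3 1 0 0.
have img (P : set 'rV[R]_0) (A : set 'rV[R]_3) : P 0 -> A (row3 1 0 0) ->
    (forall x, A x -> x = row3 1 0 0) -> f @` P = A.
  move=> P0 A0 A_eq; apply/seteqP; split=> [_ [t _ <-] //|x /A_eq ->].
  by exists 0.
apply: (@gauge_ball_pair R 0 _ _ _ (fun=> 0) f (fun=> 0)).
- by split; [exact: cst_continuous|move=> *; rewrite mulr0|exists 1 => // x []].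
- exact: cst_continuous.
- exact: cst_continuous.
- by move=> t; apply/rowP => -[].
- apply: img => [||]; rewrite /= ?ltr01 //.
    by apply/octa_cellE3 => //; rewrite !mxE /= normr1 normr0 !addr0 sgr1 sgr0.
  move=> x /(octa_cellE3 _ (_ : vertex_sign != center))[] // x1 [/sg1P a /eqP b /eqP c].
  rewrite !sgr_eq0 in b c; apply/row3_eq; rewrite (eqP b) (eqP c); split => //.
  by move: x1; rewrite (eqP b) (eqP c) normr0 !addr0 gtr0_norm.
- apply: img => [||]; rewrite /= ?ler01 //.
    by apply/closed_octa_cellE3 => //; rewrite !mxE /= normr1 normr0 !addr0 mulr1 mulr0.
  move=> x /(closed_octa_cellE3 _ (_ : vertex_sign != center))[] // x1 [/pos_normP a b c].
  rewrite !mul0r in b c; apply/row3_eq; rewrite -b -c; split => //.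
  by move: x1; rewrite -b -c normr0 !addr0 ger0_norm.
Qed.

Lemma ball_pair_edge :
  @ball_pair R 1 _ (@octa_cell R edge_sign) (@closed_octa_cell R edge_sign).
Proof.
(* The interval from -1 to 1 parametrizes the edge affinely, with 0 at the midpoint; the gauge is
   the absolute value. *)
pose f (t : 'rV[R]_1) := row3 ((1 + t ord0 ord0) / 2) ((1 - t ord0 ord0) / 2) 0.
pose h (x : 'rV[R]_3) : 'rV[R]_1 := \row_i (2 * x ord0 i0 - 1).
have hf x : x ord0 i0 + x ord0 i1 = 1 -> x ord0 i2 = 0 -> f (h x) = x.
  by move=> s1 z; apply/esym/row3_eq; rewrite !mxE z; split=> //; lra.
have ct : continuous (fun t : 'rV[R]_1 => t ord0 ord0) by exact: coord_continuous.
apply: (@gauge_ball_pair R 1 _ _ _ (fun t => `|t ord0 ord0|) f h).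
- split=> [x|t x t0|].
  + apply: continuous_comp; first exact: coord_continuous.
    exact: norm_continuous.
  + by rewrite mxE normrM (ger0_norm t0).
  + by exists 1 => // x i; rewrite mul1r (ord1 i) lexx.
- apply: row3_continuous; last exact: cst_continuous.
    move=> t; apply: (continuousM _ (@cst_continuous _ R _ t)).
    exact: continuousD (@cst_continuous _ R 1 t) (ct t).
  move=> t; apply: (continuousM _ (@cst_continuous _ R _ t)).
  exact: continuousB (@cst_continuous _ R 1 t) (ct t).
- apply: continuous_rV => i.
  have -> : (fun x => h x ord0 i) = (fun x => 2 * x ord0 i0 - 1).
    by apply/funext => x; rewrite mxE.
  move=> x; apply: (continuousB _ (@cst_continuous _ R 1 x)).
  apply: (continuousM (@cst_continuous _ R 2 x)); exact: coord_continuous.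
- by move=> t; apply/rowP => i; rewrite ord1 !mxE /=; field.
- apply/seteqP; split=> [_ [t /= + <-]|x /(octa_cellE3 _ (_ : edge_sign != center))[]].
  + rewrite ltr_norml => /andP[a b].
    have p0 : 0 < (1 + t ord0 ord0) / 2 by lra.
    have p1 : 0 < (1 - t ord0 ord0) / 2 by lra.
    apply/octa_cellE3 => //; rewrite !mxE /= sgr0 normr0 !gtr0_norm //.
    by split; [lra|split=> //; apply/sg1P].
  + by [].
  + move=> x1 [/sg1P a /sg1P b /eqP]; rewrite sgr_eq0 => /eqP c.
    rewrite c normr0 addr0 !gtr0_norm // in x1; exists (h x); last exact: hf.
    by rewrite /= mxE ltr_norml; apply/andP; split; lra.
- apply/seteqP; split=> [_ [t /= + <-]|x /(closed_octa_cellE3 _ (_ : edge_sign != center))[]].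
  + rewrite ler_norml => /andP[a b].
    have p0 : 0 <= (1 + t ord0 ord0) / 2 by lra.
    have p1 : 0 <= (1 - t ord0 ord0) / 2 by lra.
    apply/closed_octa_cellE3 => //; rewrite !mxE /= normr0 mulr0 !ger0_norm //.
    by rewrite !mul1r; split; [lra|split].
  + by [].
  + move=> x1 [/pos_normP a /pos_normP b]; rewrite mul0r => c.
    rewrite -c normr0 addr0 !ger0_norm // in x1; exists (h x); last exact: hf.
    by rewrite /= mxE ler_norml; apply/andP; split; lra.
Qed.

Lemma ball_pair_face :
  @ball_pair R 2 _ (@octa_cell R face_sign) (@closed_octa_cell R face_sign).
Proof.
pose j0 : 'I_2 := ord0; pose j1 : 'I_2 := ord_max.
have ord2 (i : 'I_2) : i = j0 \/ i = j1.
  by case: i => [[|[|//]] lti]; [left|right]; apply/val_inj.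
(* An affine chart of the plane of the triangle, with the origin at the barycenter. The three
   coordinates are nonnegative exactly when [g t <= 1] for the maximum [g] below. *)
pose f (t : 'rV[R]_2) := row3 ((1 + t ord0 j0) / 3) ((1 + t ord0 j1) / 3)
  ((1 - (t ord0 j0 + t ord0 j1)) / 3).
pose h (x : 'rV[R]_3) : 'rV[R]_2 :=
  \row_i (3 * x ord0 (if i == j0 then i0 else i1) - 1).
pose g (t : 'rV[R]_2) := Num.max (- t ord0 j0)
  (Num.max (- t ord0 j1) (t ord0 j0 + t ord0 j1)).
have hf x : x ord0 i0 + x ord0 i1 + x ord0 i2 = 1 -> f (h x) = x.
  by move=> s1; apply/esym/row3_eq; rewrite !mxE /=; split; lra.
have ct j : continuous (fun t : 'rV[R]_2 => t ord0 j) by exact: coord_continuous.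
have cN j : continuous (fun t : 'rV[R]_2 => - t ord0 j).
  by move=> t; exact: continuousN (ct j t).
have cD : continuous (fun t : 'rV[R]_2 => t ord0 j0 + t ord0 j1).
  by move=> t; exact: continuousD (ct j0 t) (ct j1 t).
apply: (@gauge_ball_pair R 2 _ _ _ g f h).
- split=> [x|t x t0|].
  + exact: (continuous_max (cN j0 x) (continuous_max (cN j1 x) (cD x))).
  + by rewrite /g !mxE !maxr_pMr // -!mulrN mulrDr.
  (* Each coordinate is the sum of both minus the other one, hence at most [2 * g x]. The three
     lower bounds on [g x] add up to [0 <= 3 * g x], which settles the other sign. *)
  + exists 2 => // x i.
    have g0 : - x ord0 j0 <= g x by rewrite /g le_max lexx.
    have g1 : - x ord0 j1 <= g x by rewrite /g !le_max lexx orbT.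
    have g2 : x ord0 j0 + x ord0 j1 <= g x by rewrite /g !le_max lexx !orbT.
    by rewrite ler_norml; case: (ord2 i) => ->; apply/andP; split; lra.
- apply: row3_continuous => t; apply: (continuousM _ (@cst_continuous _ R _ t)).
  + exact: continuousD (@cst_continuous _ R 1 t) (ct j0 t).
  + exact: continuousD (@cst_continuous _ R 1 t) (ct j1 t).
  + exact: continuousB (@cst_continuous _ R 1 t) (cD t).
- apply: continuous_rV => i.
  have -> : (fun x => h x ord0 i) = (fun x => 3 * x ord0 (if i == j0 then i0 else i1) - 1).
    by apply/funext => x; rewrite mxE.
  move=> x; apply: (continuousB _ (@cst_continuous _ R 1 x)).
  apply: (continuousM (@cst_continuous _ R 3 x)); exact: coord_continuous.
- by move=> t; apply/rowP => i; rewrite mxE; case: (ord2 i) => -> /=; rewrite mxE /=; field.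
- apply/seteqP; split=> [_ [t /= + <-]|x /(octa_cellE3 _ (_ : face_sign != center))[]].
  + rewrite /g !gt_max => /and3P[a b c].
    have p0 : 0 < (1 + t ord0 j0) / 3 by lra.
    have p1 : 0 < (1 + t ord0 j1) / 3 by lra.
    have p2 : 0 < (1 - (t ord0 j0 + t ord0 j1)) / 3 by lra.
    apply/octa_cellE3 => //; rewrite !mxE /= !gtr0_norm //.
    by split; [lra|split; apply/sg1P].
  + by [].
  + move=> x1 [/sg1P a /sg1P b /sg1P c].
    rewrite !gtr0_norm // in x1; exists (h x); last exact: hf.
    by rewrite /= /g !mxE /= !gt_max; apply/and3P; split; lra.
- apply/seteqP; split=> [_ [t /= + <-]|x /(closed_octa_cellE3 _ (_ : face_sign != center))[]].
  + rewrite /g !ge_max => /and3P[a b c].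
    have p0 : 0 <= (1 + t ord0 j0) / 3 by lra.
    have p1 : 0 <= (1 + t ord0 j1) / 3 by lra.
    have p2 : 0 <= (1 - (t ord0 j0 + t ord0 j1)) / 3 by lra.
    apply/closed_octa_cellE3 => //; rewrite !mxE /= !ger0_norm //.
    by rewrite !mul1r; split; [lra|split].
  + by [].
  + move=> x1 [/pos_normP a /pos_normP b /pos_normP c].
    rewrite !ger0_norm // in x1; exists (h x); last exact: hf.
    by rewrite /= /g !mxE /= !ge_max; apply/and3P; split; lra.
Qed.

End RegularOctahedron.

(* The 48 symmetries, as words in the generators [gen 0], ..., [gen 4]: sign changes
   followed by a permutation of the coordinates. *)
Definition symmetries : seq (seq nat) :=
  [seq p ++ q | p <- [:: [::]; [:: 0]; [:: 1]; [:: 0; 1]; [:: 1; 0]; [:: 0; 1; 0]],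
                q <- [:: [::]; [:: 2]; [:: 3]; [:: 4]; [:: 2; 3]; [:: 2; 4]; [:: 3; 4];
                         [:: 2; 3; 4]]]%N.

(** The symmetries act transitively on the cells of each dimension, so one characteristic map per
    dimension suffices. *)
Lemma gens_base k : exists s b, k = gens s b /\
  b \in [:: center; vertex_sign; edge_sign; face_sign].
Proof.
have /hasP[s _ /hasP[b bb /eqP E]] : has (fun s => has (fun b => gens s b == k)
    [:: center; vertex_sign; edge_sign; face_sign]) symmetries.
  by move: k; apply: forall_sign3; vm_compute.
by exists s, b.
Qed.

Section OctaComplex.
Variable R : realType.
Implicit Types k w : sign3.

Lemma octa_ball_pair k :
  @ball_pair R (sdim k) _ (@octa_cell R k) (@closed_octa_cell R k).
Proof.
have [s [b [-> bb]]] := gens_base k.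
have dims : sdim (gens s b) = sdim b by elim: s => //= n s IH; rewrite sdim_gen.
rewrite dims; apply: gens_ball_pair.
move: bb; rewrite !inE => /or4P[] /eqP ->.
- exact: ball_pair_center.
- exact: ball_pair_vertex.
- exact: ball_pair_edge.
- exact: ball_pair_face.
Qed.

Lemma sle_sdim w k : sle w k -> w = k \/ (sdim w < sdim k)%N.
Proof.
have : (sle w k) ==> (w == k) || (sdim w < sdim k)%N.
  by move: k; apply: forall_sign3; move: w; apply: forall_sign3; vm_compute.
by move=> /implyP h /h /orP[/eqP|]; [left|right].
Qed.

Lemma octa_regular : regular_cell_complex R (octa R).
Proof.
split.
- exact: norm_hausdorff.
- by move=> k w _ _ [x [kx wx]]; exact: octa_cell_uniq kx wx.
- by move=> k; rewrite /= closure_octa_cell; exact: octa_ball_pair.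
- move=> k; exists [set w | sle w k && (w != k)]; last first.
    by move=> w /andP[/sle_sdim[->|//]]; rewrite eqxx.
  rewrite /cboundary /= closure_octa_cell closed_octa_cellE.
  apply/seteqP; split=> [x [[w /= wk wx] nkx]|x [w /andP[wk w_neq] wx]].
    exists w => //; rewrite /= wk; apply: contra_notN nkx => /eqP <- //.
  split; first by exists w.
  by move=> kx; move: w_neq; rewrite (octa_cell_uniq wx kx) eqxx.
Qed.

Lemma octa_cell_le : @cell_le (octa R) = sle.
Proof.
apply/funext => w; apply/funext => k; apply/idP/idP => [/asboolP|wk].
  rewrite /= closure_octa_cell closed_octa_cellE.
  by rewrite -[\bigcup_(_ in _) _]/(@cells (octa R) [set w | sle w k]) (cells_sub octa_regular).
apply/asboolP; rewrite /= closure_octa_cell closed_octa_cellE => x wx.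
by exists w.
Qed.

End OctaComplex.

(** * Enumeration of the templates *)

(* An edge with its tail and its head. *)
Definition arc : Type := (sign3 * sign3 * sign3)%type.

Record code := Code {
  arcs : seq arc; cN : sign3; cS : sign3; cWE : seq sign3; cEW : seq sign3;
  cW : seq sign3; cE : seq sign3
}.

Definition cells_of_dim n : seq sign3 := [seq k <- all_signs | sdim k == n].

(** The order of the two vertices is that of [all_signs] and is unrelated to any orientation. *)
Definition endpoints (e : sign3) : sign3 * sign3 :=
  let vs := [seq v <- cells_of_dim 0 | sle v e] in
  (nth center vs 0, nth center vs 1).

Definition on_code_path (p : seq sign3) v := has (sle v) p.

Definition free_cells (we ew : seq sign3) : seq sign3 :=
  [seq v <- all_signs | (v != center) && ~~ (on_code_path we v || on_code_path ew v)].

Definition touches (S : seq sign3) (v : sign3) : bool :=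
  has (fun u => sle u v || sle v u) S.

(* Breadth-first search in [X] from the frontier [S]. Reaching the whole component is
   not proved for any value of the fuel [n]: it is tested in each case, in
   [hemisphere_check] and [is_region]. *)
Fixpoint explore n (X S : seq sign3) : seq sign3 :=
  if n is n'.+1 then
    if S is [::] then [::] else
    S ++ explore n' [seq v <- X | ~~ touches S v] [seq v <- X | touches S v]
  else [::].

Definition region we ew f :=
  explore 20 [seq v <- free_cells we ew | v != f] [:: f].

Definition coregion we ew (W : seq sign3) := [seq v <- free_cells we ew | v \notin W].

(** Every edge points from the earlier to the later vertex in [o], which excludes directed
    cycles. *)
Definition order_arcs (o : seq sign3) : seq arc :=
  [seq (let: (u, v) := endpoints e in
        if (index u o < index v o)%N then (e, u, v) else (e, v, u)) | e <- cells_of_dim 1].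

Definition axis_vertex (i : nat) (s : bool) : sign3 :=
  match i with
  | 0 => (Some s, None, None) | 1 => (None, Some s, None) | _ => (None, None, Some s)
  end.

Definition vN := axis_vertex 0 true.
Definition vS := axis_vertex 1 true.

(** The western hemisphere is taken to be the component of [face_sign], the triangle on [vN], [vS]
    and the vertex [axis_vertex 2 true]. *)
Definition code_of_order o we ew : code :=
  let W := region we ew face_sign in
  Code (order_arcs o) vN vS we ew W (coregion we ew W).

Definition edge01 (a b : bool) : sign3 := (Some a, Some b, None).
Definition edge02 (a b : bool) : sign3 := (Some a, None, Some b).
Definition edge12 (a b : bool) : sign3 := (None, Some a, Some b).

(* Besides N, S and m, there remain the antipodes a, b, c of N, S, m. Since b is not
   adjacent to S it cannot come last among them; this leaves four orders. *)
Definition vertex_order (i : nat) : seq sign3 :=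
  let m := axis_vertex 2 true in
  let a := axis_vertex 0 false in
  let b := axis_vertex 1 false in
  let c := axis_vertex 2 false in
  match i with
  | 0 => [:: vN; m; b; c; a; vS]
  | 1 => [:: vN; m; a; b; c; vS]
  | 2 => [:: vN; m; b; a; c; vS]
  | _ => [:: vN; m; c; b; a; vS]
  end.

(** [vertex_order 4] falls into the default branch, so the last two codes share their orientation
    and differ in their meridians. In the first four the edge from [vN] to [vS] is itself a
    meridian; in the last it is interior to the west. *)
Definition five_codes (i : nat) : code :=
  if (i < 4)%N then
    code_of_order (vertex_order i) [:: edge01 true true]
      [:: edge02 true true; edge12 true true]
  else code_of_order (vertex_order 4) [:: edge02 true true; edge12 true true]
         [:: edge02 true false; edge12 true false].

(** Arcs into [N] or out of [S] are discarded at once. This leaves five undetermined edges for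
    adjacent poles and four for antipodal ones. *)
Definition arc_choices N S e : seq arc :=
  let: (u, v) := endpoints e in
  [seq a <- [:: (e, u, v); (e, v, u)] | (a.2 != N) && (a.1.2 != S)].

Fixpoint orientations N S (es : seq sign3) : seq (seq arc) :=
  if es is e :: es' then
    [seq a :: l | a <- arc_choices N S e, l <- orientations N S es']
  else [:: [::]].

Fixpoint dipaths n (A : seq arc) u v : seq (seq sign3) :=
  (if u == v then [:: [::]] else [::]) ++
  if n is n'.+1 then
    flatten [seq [seq a.1.1 :: p | p <- dipaths n' A a.2 v] | a <- [seq a <- A | a.1.2 == u]]
  else [::].

(* A shortest directed cycle has no chord, hence at most 4 vertices in the octahedron. *)
Definition no_short_cycle (A : seq arc) : bool :=
  all (fun a => nilp (dipaths 3 A a.2 a.1.2)) A.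

Definition code_overlap N (W E p : seq sign3) : bool :=
  has (fun f => [&& f \in W, sle (head N p) f &
     has (fun f' => [&& f' \in E, sle (last N p) f' & has (fun e => sle e f && sle e f') p])
       (cells_of_dim 2)]) (cells_of_dim 2).

(** At a meridian vertex other than a pole a western edge must end and an eastern edge must start.
    Hence a western tail or an eastern head is off the meridians or a pole. *)
Definition code_transverse (c : code) : bool :=
  let pole v := (v == cN c) || (v == cS c) in
  let onm v := on_code_path (cWE c) v || on_code_path (cEW c) v in
  all (fun a => ((a.1.1 \in cW c) ==> ~~ onm a.1.2 || pole a.1.2) &&
                ((a.1.1 \in cE c) ==> ~~ onm a.2 || pole a.2)) (arcs c).

Definition code_kappa (c : code) : code :=
  Code [seq (a.1.1, a.2, a.1.2) | a <- arcs c] (cS c) (cN c) (rev (cEW c)) (rev (cWE c))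
    (cE c) (cW c).

Definition code_rho (c : code) : code :=
  Code (arcs c) (cN c) (cS c) (cEW c) (cWE c) (cW c) (cE c).

(* Here and below, conditionals replace Boolean connectives because [vm_compute]
   evaluates both arguments of the latter. *)
Definition code_match (g : sign3 -> sign3) (c t : code) : bool :=
  if (g (cN c), g (cS c)) != (cN t, cS t) then false else
  if (map g (cWE c), map g (cEW c)) != (cWE t, cEW t) then false else
  if ~~ all (fun a => (g a.1.1, g a.1.2, g a.2) \in arcs t) (arcs c) then false else
  all (fun v => ((g v \in cW t) == (v \in cW c)) && ((g v \in cE t) == (v \in cE c)))
    all_signs.

Definition code_known (c : code) : bool :=
  has (fun i => has (fun a => has (fun b => let t := five_codes i in
    let c' := iter (nat_of_bool a) code_kappa (iter (nat_of_bool b) code_rho c) in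
    has (fun s => code_match (gens s) c' t)
     symmetries) [:: false; true]) [:: false; true]) (iota 0 5).

Definition code_check (c : code) : bool :=
  if code_transverse c then
    if code_overlap (cN c) (cW c) (cE c) (cWE c) then
      if code_overlap (cN c) (cW c) (cE c) (cEW c) then code_known c else true
    else true
  else true.

(* Testing vertices only is enough for the enumeration. *)
Definition disjoint_check N S (we ew : seq sign3) : bool :=
  if we == ew then false else
  all (fun v => if on_code_path we v then if on_code_path ew v then (v == N) || (v == S)
    else true else true) (cells_of_dim 0).

Definition bipolar_check N S (A : seq arc) : bool :=
  all (fun v => (if v == N then true else has (fun a => a.2 == v) A) &&
                (if v == S then true else has (fun a => a.1.2 == v) A)) (cells_of_dim 0).

Definition hemisphere_check N S A we ew W : bool :=
  if has (touches W) (coregion we ew W) then false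
  else code_check (Code A N S we ew W (coregion we ew W)).

(** By the overlap condition some western face is incident with the first edge of [we], so every
    face at that edge is tried as a starting point of the exploration. *)
Definition meridians_check N S A we ew : bool :=
  all (fun f => if sle (head N we) f then hemisphere_check N S A we ew (region we ew f)
                else true) (cells_of_dim 2).

Definition paths_check N S A ps : bool :=
  all (fun we => all (fun ew =>
    if disjoint_check N S we ew then meridians_check N S A we ew else true) ps) ps.

Definition orientation_check N S A : bool :=
  if bipolar_check N S A then
    if no_short_cycle A then paths_check N S A (dipaths 6 A N S) else true
  else true.

Definition search N S : bool :=
  all (orientation_check N S) (orientations N S (cells_of_dim 1)).

Lemma search_adjacent : search vN vS.
Proof. by vm_compute. Qed.

(** All five codes have adjacent poles and symmetries preserve adjacency, so [code_known] fails for
    antipodal poles. Success of the search therefore means that no candidate passes the earlier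
    tests. *)
Lemma search_antipodal : search vN (axis_vertex 0 false).
Proof. by vm_compute. Qed.

(** * Completeness of the enumeration *)

Arguments cells_of_dim : simpl never.
Arguments endpoints : simpl never.

Lemma mem_cells_of_dim n k : (k \in cells_of_dim n) = (sdim k == n).
Proof. by rewrite mem_filter mem_all_signs andbT. Qed.

Lemma linked_trans (L : Type) (r : rel L) X u v w :
  linked r X u v -> linked r X v w -> linked r X u w.
Proof.
move=> uv; elim=> // {}w w' _ uw Xw' ww'; exact: linkedS uw Xw' ww'.
Qed.

Lemma linked_sym (L : Type) (r : rel L) (X : L -> Prop) u v :
  X u -> linked r X u v -> linked r X v u.
Proof.
move=> Xu uv.
(* A reversed step arrives at the older cell, so its membership in [X] is carried through the
   induction. *)
have [] : linked r X v u /\ X v; last by [].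
elim: uv => [|{}v w _ [vu Xv] Xw vw]; first by split=> //; exact: linked0.
split=> //; apply: linked_trans vu.
by apply: (linkedS (linked0 _ _ _) Xv); rewrite orbC.
Qed.

Lemma linked_class (L : Type) (r : rel L) (X : L -> Prop) u v :
  X u -> linked r X u v -> linked r X u = linked r X v.
Proof.
move=> Xu uv; apply/funext => z; apply/propext; split=> lz.
  exact: linked_trans (linked_sym Xu uv) lz.
exact: linked_trans uv lz.
Qed.

Lemma code_checkP t : code_transverse t ->
  code_overlap (cN t) (cW t) (cE t) (cWE t) ->
  code_overlap (cN t) (cW t) (cE t) (cEW t) -> code_check t -> code_known t.
Proof. by rewrite /code_check => -> -> ->. Qed.

Section Classification.
Variable c : combi sign3.
Hypotheses (T : combi_template c) (dimE : dim c = sdim) (leE : le c = sle).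
Hypothesis NS : pN c <> pS c.

(* Arcs are stored for edges only, so nothing is said about [tl] and [hd] on other
   cells. *)
Record represents (c' : combi sign3) (t : code) : Prop := {
  rep_arc : forall e, sdim e == 1%N -> (e, tl c' e, hd c' e) \in arcs t;
  rep_N : cN t = pN c';
  rep_S : cS t = pS c';
  rep_WE : cWE t = pWE c';
  rep_EW : cEW t = pEW c';
  rep_west : forall v, (v \in cW t) <-> west c' v;
  rep_east : forall v, (v \in cE t) <-> east c' v
}.

Definition combi_arcs : seq arc := [seq (e, tl c e, hd c e) | e <- cells_of_dim 1].

Lemma dim_edge e : (e \in cells_of_dim 1) = (dim c e == 1%N).
Proof. by rewrite mem_cells_of_dim dimE. Qed.

Lemma arcP a : reflect (exists2 e, dim c e == 1%N & a = (e, tl c e, hd c e)) (a \in combi_arcs).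
Proof.
apply: (iffP mapP) => -[e]; rewrite ?dim_edge => de ->; exists e => //.
by rewrite dim_edge.
Qed.

Lemma endpointsP e : dim c e == 1%N ->
  endpoints e = (tl c e, hd c e) \/ endpoints e = (hd c e, tl c e).
Proof.
move=> de; have [ne inc] := ct_orient T de.
have : let: (u, v) := endpoints e in
    [&& u != v, sle u e, u != e, sle v e & v != e].
  have : (sdim e == 1%N) ==> (let: (u, v) := endpoints e in
    [&& u != v, sle u e, u != e, sle v e & v != e]).
    by move: (e); apply: forall_sign3; vm_compute.
  by rewrite -dimE de.
case: (endpoints e) => u v /and5P[uv ue /eqP u_ne ve /eqP v_ne].
have uE : u = tl c e \/ u = hd c e by apply/inc; rewrite leE.
have vE : v = tl c e \/ v = hd c e by apply/inc; rewrite leE.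
by move: uv; case: uE => ->; case: vE => ->; rewrite ?eqxx //; [left|right].
Qed.

Lemma endpoint_vertices e : dim c e == 1%N ->
  sdim (tl c e) == 0%N /\ sdim (hd c e) == 0%N.
Proof.
move=> de; have : (sdim e == 1%N) ==>
    (sdim (endpoints e).1 == 0%N) && (sdim (endpoints e).2 == 0%N).
  by move: (e); apply: forall_sign3; vm_compute.
by rewrite -{1}dimE de implyTb => /andP[]; case: (endpointsP de) => ->.
Qed.

Lemma N_vertex : sdim (pN c) == 0%N.
Proof. by have [] := (ct_source T (pN c)).2 erefl; rewrite dimE. Qed.

Lemma orientationsP N S es (g : sign3 -> arc) :
  {in es, forall e, g e \in arc_choices N S e} ->
  map g es \in orientations N S es.
Proof.
elim: es => [|e es IH] h; first by rewrite inE.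
rewrite /=; apply/allpairsP; exists (g e, map g es); split=> //=.
  by apply: h; rewrite mem_head.
by apply: IH => e' ee'; apply: h; rewrite inE ee' orbT.
Qed.

Lemma N_source e : dim c e == 1%N -> hd c e <> pN c.
Proof. by move=> de; have [_ /(_ e de)] := (ct_source T (pN c)).2 erefl. Qed.

Lemma S_sink e : dim c e == 1%N -> tl c e <> pS c.
Proof. by move=> de; have [_ /(_ e de)] := (ct_sink T (pS c)).2 erefl. Qed.

Lemma arcs_orientation : combi_arcs \in orientations (pN c) (pS c) (cells_of_dim 1).
Proof.
apply: orientationsP => e; rewrite dim_edge => de.
have /eqP hN := N_source de; have /eqP tS := S_sink de.
rewrite /arc_choices; case: (endpointsP de) => ->.
  by rewrite mem_filter /= hN tS !inE eqxx.
by rewrite mem_filter /= hN tS !inE eqxx orbT.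
Qed.

Lemma arcs_bipolar : bipolar_check (pN c) (pS c) combi_arcs.
Proof.
apply/allP => v; rewrite mem_cells_of_dim -dimE => dv; apply/andP; split.
  case: eqP => // vN; apply: contraT => /hasPn h.
  case: vN; apply/(ct_source T); split=> // e de he.
  have /h : (e, tl c e, hd c e) \in combi_arcs by apply/arcP; exists e.
  by rewrite /= he eqxx.
case: eqP => // vS; apply: contraT => /hasPn h.
case: vS; apply/(ct_sink T); split=> // e de he.
have /h : (e, tl c e, hd c e) \in combi_arcs by apply/arcP; exists e.
by rewrite /= he eqxx.
Qed.

Lemma dipaths_sound (B : seq arc) n u v p : {subset B <= combi_arcs} ->
  p \in dipaths n B u v -> cdipath c u p v.
Proof.
move=> BA.
elim: n u p => [|n IH] u p /=.
  by rewrite cats0; case: eqP => [->|//]; rewrite inE => /eqP -> /=.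
rewrite mem_cat => /orP[|].
  by case: eqP => [->|//]; rewrite inE => /eqP -> /=.
move=> /flattenP[_ /mapP[a + ->] /mapP[q qa ->]].
rewrite mem_filter => /andP[/eqP au /BA/arcP[e de aE]].
by move: au qa; rewrite aE /= de => -> /IH ->; rewrite eqxx.
Qed.

Lemma dipaths_complete (B : seq arc) n u v p : {subset combi_arcs <= B} ->
  cdipath c u p v -> (size p <= n)%N -> p \in dipaths n B u v.
Proof.
move=> AB.
elim: n u p => [|n IH] u p.
  by case: p => //= /eqP -> _; rewrite eqxx inE.
case: p => [/= /eqP -> _|e p /= /and3P[de /eqP tu hp] sp]; rewrite mem_cat.
  by rewrite eqxx inE.
apply/orP; right; apply/flattenP.
exists [seq e :: q | q <- dipaths n B (hd c e) v]; last first.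
  by apply: map_f; exact: IH.
apply/mapP; exists (e, tl c e, hd c e) => //.
by rewrite mem_filter /= tu eqxx; apply/AB/arcP; exists e; rewrite ?tu.
Qed.

Lemma arcs_no_short_cycle : no_short_cycle combi_arcs.
Proof.
apply/allP => _ /arcP[e de ->].
rewrite -[_.2]/(hd c e) -[_.2]/(tl c e); case E: (dipaths _ _ _ _) => [//|p l].
have /(dipaths_sound (fun a => id)) hp : p \in dipaths 3 combi_arcs (hd c e) (tl c e).
  by rewrite E mem_head.
by have /(ct_acyclic T) : cdipath c (tl c e) (e :: p) (tl c e) by rewrite /= de eqxx.
Qed.

Lemma cdipath_split u p e q v : cdipath c u (p ++ e :: q) v -> cdipath c u p (tl c e).
Proof.
elim: p u => [|e' p IH] u /=; first by case/and3P=> _ /eqP ->.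
by case/and3P=> -> -> /IH ->.
Qed.

Lemma cdipath_edges u p v : cdipath c u p v -> {in p, forall e, dim c e == 1%N}.
Proof.
elim: p u => [//|e p IH] u /= /and3P[de _ /IH h] e'; rewrite inE => /orP[/eqP -> //|].
exact: h.
Qed.

(* In an acyclic orientation the tails of the edges of a path are distinct, and there
   are 6 vertices. *)
Lemma cdipath_size u p v : cdipath c u p v -> (size p <= 6)%N.
Proof.
move=> up; have up_edges := cdipath_edges up.
have -> : 6%N = size (cells_of_dim 0) by vm_compute.
rewrite -(size_map (tl c) p); apply: uniq_leq_size; last first.
  by move=> _ /mapP[e pe ->]; rewrite mem_cells_of_dim (endpoint_vertices _).1 ?up_edges.
elim: p u up {up_edges} => [//|e p IH] u /=.
move=> /and3P[de /eqP tu hp]; rewrite (IH _ hp) andbT tu.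
apply/negP => /mapP[e' pe' uE]; case/splitPr: pe' hp => p1 p2 /cdipath_split hp.
have /(ct_acyclic T) : cdipath c u (e :: p1) u by rewrite /= de tu eqxx /= uE.
by [].
Qed.

Lemma S_vertex : sdim (pS c) == 0%N.
Proof. by have [] := (ct_sink T (pS c)).2 erefl; rewrite dimE. Qed.

Lemma meridians_disjoint : disjoint_check (pN c) (pS c) (pWE c) (pEW c).
Proof.
have on v p : on_code_path p v = on_path c p v by rewrite /on_path leE.
(* Equal meridians would share their first edge, whereas they only share the poles; they cannot be
   empty because the poles differ. *)
rewrite /disjoint_check; case: eqP => [E|_].
  have := ct_WE T; have := ct_disjoint T; rewrite -E; case: (pWE c) => [|e p] D.
    by rewrite /= => /eqP.
  have /D : on_path c (e :: p) e /\ on_path c (e :: p) e.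
    by rewrite /= leE (_ : sle e e) //; case: (e) => [[[[]|] [[]|]] [[]|]].
  move=> eN; rewrite /= dimE => /andP[].
  by case: eN => ->; [rewrite (eqP N_vertex)|rewrite (eqP S_vertex)].
apply/allP => v _; rewrite !on; case: ifP => // v1; case: ifP => // v2.
by have /(ct_disjoint T)[->|->] := conj v1 v2; rewrite eqxx ?orbT.
Qed.

Definition sphere_rest := off_meridians c center.
Definition free := free_cells (pWE c) (pEW c).

Lemma free_cellsP v : reflect (sphere_rest v) (v \in free).
Proof.
rewrite /free /free_cells mem_filter mem_all_signs andbT.
apply: (iffP andP) => -[v0]; rewrite /on_code_path -leE => nv.
  by split=> //; apply/eqP.
by split=> //; apply/eqP.
Qed.

Lemma hemispheres : [/\ west c <> east c,
  exists2 v, sphere_rest v & west c = linked sle sphere_rest v,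
  exists2 v, sphere_rest v & east c = linked sle sphere_rest v &
  forall v, sphere_rest v ->
    linked sle sphere_rest v = west c \/ linked sle sphere_rest v = east c].
Proof.
have [b [db _ neq comp]] := ct_ball T.
have b0 : b = center.
  apply/eqP; have : (sdim b == 3) ==> (b == center).
    by move: (b); apply: forall_sign3; vm_compute.
  by rewrite -{1}dimE db eqxx.
rewrite b0 leE -/sphere_rest in comp; split=> //.
- by apply/comp; left.
- by apply/comp; right.
- by move=> v Xv; apply/comp; exists v.
Qed.

(** A property that passes to incident free cells is an invariant of the exploration, whatever the
    fuel. *)
Lemma explore_sub (P : set sign3) n Y S :
  (forall u v, P u -> sphere_rest v -> sle u v || sle v u -> P v) ->
  {subset Y <= free} -> {in S, forall v, P v} ->
  {in explore n Y S, forall v, P v}.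
Proof.
move=> Pclosed; elim: n Y S => [//|n IH] Y [//|s S] YX SP v.
have newP w : w \in [seq v <- Y | touches (s :: S) v] -> P w.
  rewrite mem_filter => /andP[/hasP[u uS uw] /YX/free_cellsP Xw].
  exact: Pclosed (SP _ uS) Xw uw.
rewrite /explore -/explore mem_cat => /orP[|]; first exact: SP.
apply: IH => [w|w]; last exact: newP.
by rewrite mem_filter => /andP[_ /YX].
Qed.

Lemma mem_explore n Y f S : f \in explore n.+1 Y (f :: S).
Proof. by rewrite /= inE eqxx. Qed.

Lemma face_mem_region f we ew : f \in region we ew f.
Proof. exact: (mem_explore 19). Qed.

(** The west is closed under incidence among free cells, so the exploration stays in it. Conversely
    a chain from [f] cannot leave a region that touches none of the remaining free cells. *)
Lemma region_west f : west c f -> sphere_rest f ->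
  ~~ has (touches (region (pWE c) (pEW c) f))
    (coregion (pWE c) (pEW c) (region (pWE c) (pEW c) f)) ->
  forall v, (v \in region (pWE c) (pEW c) f) <-> west c v.
Proof.
move=> wf Xf /hasPn sep v; have [_ [v0 Xv0 westE] _ _] := hemispheres.
split.
  apply: explore_sub => [{}u w|w|w]; first 2 last.
  - by rewrite inE => /eqP ->.
  - by rewrite westE => uu Xw uw; exact: linkedS uu Xw uw.
  - by rewrite mem_filter => /andP[].
move=> wv.
have : linked sle sphere_rest f v.
  by move: wf wv; rewrite westE => /(linked_sym Xv0); exact: linked_trans.
elim=> [|u w _ uW Xw uw]; first exact: face_mem_region.
apply: contraT => wW.
have /sep /negP[] : w \in coregion (pWE c) (pEW c) (region (pWE c) (pEW c) f).
  by rewrite mem_filter wW; exact/free_cellsP.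
by apply/hasP; exists u.
Qed.

Lemma east_off_west v : east c v <-> sphere_rest v /\ ~ west c v.
Proof.
have [neq [v0 Xv0 westE] [v1 Xv1 eastE] comp] := hemispheres.
have linked_X u w : sphere_rest u -> linked sle sphere_rest u w -> sphere_rest w.
  by move=> Xu [|].
split=> [ev|[Xv nw]].
  have lv : linked sle sphere_rest v1 v by rewrite -eastE.
  split=> [|wv]; first exact: linked_X lv.
  apply: neq; rewrite westE eastE (linked_class Xv1 lv) (linked_class Xv0 (_ : _ v)) //.
  by rewrite -westE.
have [E|E] := comp _ Xv; last by rewrite -E; exact: linked0.
by case: nw; rewrite -E; exact: linked0.
Qed.

Lemma in_dipaths u p v : cdipath c u p v -> p \in dipaths 6 combi_arcs u v.
Proof.
by move=> up; apply: dipaths_complete up (cdipath_size up).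
Qed.

(** The search is specialized to the orientation and the meridians of [c] itself. Each test on the
    way is a consequence of the template conditions, so the final verdict [code_known] applies. *)
Lemma known_of_search : search (pN c) (pS c) ->
  exists t, represents c t /\ code_known t.
Proof.
move=> /allP /(_ _ arcs_orientation).
rewrite /orientation_check arcs_bipolar arcs_no_short_cycle.
move=> /allP /(_ _ (in_dipaths (ct_WE T))) /allP /(_ _ (in_dipaths (ct_EW T))).
rewrite meridians_disjoint => /allP.
(* The western face at the first edge of the meridian is the starting point of the exploration. *)
have [fW [fE [[[dfW wfW hfW] _] [[dfE efE lfE] _] [e eWE [eW eE]]]]] := ct_overlap_WE T.
move=> /(_ fW); rewrite mem_cells_of_dim -dimE -leE dfW hfW => /(_ isT).
pose W := region (pWE c) (pEW c) fW; pose E := coregion (pWE c) (pEW c) W.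
pose t := Code combi_arcs (pN c) (pS c) (pWE c) (pEW c) W E.
rewrite -/W /hemisphere_check -/E -/t.
(* A region touching its complement would make the search answer [false]; hence the exploration has
   reached its whole component. *)
case: ifP => // /negbT sep.
have XfW : sphere_rest fW.
  have [_ [v0 Xv0 westE] _ _] := hemispheres.
  by move: wfW; rewrite westE => -[|].
have in_west := region_west wfW XfW sep; rewrite -/W in in_west.
have in_east v : (v \in E) <-> east c v.
  rewrite east_off_west mem_filter; split=> [/andP[/negP vW /free_cellsP Xv]|[Xv nv]].
    by split=> // /in_west.
  by apply/andP; split; [apply/negP => /in_west|exact/free_cellsP].
move=> check.
exists t; split.
  split=> // e' de'; apply/arcP; exists e' => //.
  by rewrite dimE de'.
have overlap p : coverlap c p -> code_overlap (pN c) W E p.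
  move=> [gW [gE [[[dgW wgW hgW] _] [[dgE egE lgE] _] [e' ep [eW' eE']]]]].
  apply/hasP; exists gW; first by rewrite mem_cells_of_dim -dimE.
  apply/and3P; split; [exact/in_west|by rewrite -leE|].
  apply/hasP; exists gE; first by rewrite mem_cells_of_dim -dimE.
  apply/and3P; split; [exact/in_east|by rewrite -leE|].
  by apply/hasP; exists e' => //; rewrite -leE eW' eE'.
apply: code_checkP check; [|exact: overlap (ct_overlap_WE T)|exact: overlap (ct_overlap_EW T)].
have onE v : on_code_path (pWE c) v || on_code_path (pEW c) v = on_meridians c v.
  by rewrite /on_meridians /on_path leE.
apply/allP => a /arcP[e' de' ->] /=; rewrite !onE.
have [ne inc] := ct_orient T de'.
have tle : le c (tl c e') e' by have [] := (inc (tl c e')).2 (or_introl erefl).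
have hde : le c (hd c e') e' by have [] := (inc (hd c e')).2 (or_intror erefl).
have [htl hhd] := endpoint_vertices de'; rewrite -dimE in htl hhd.
apply/andP; split; apply/implyP.
  move=> /in_west we; case: (boolP (on_meridians _ _)) => //= onm.
  (* Otherwise [ct_towards] would identify the tail of this edge with its head. *)
  apply: contraT; rewrite negb_or => /andP[/eqP tN /eqP tS].
  by move: ne; rewrite -(ct_towards T de' we htl tle onm tN tS) eqxx.
move=> /in_east ee; case: (boolP (on_meridians _ _)) => //= onm.
apply: contraT; rewrite negb_or => /andP[/eqP tN /eqP tS].
by move: ne; rewrite (ct_away T de' ee hhd hde onm tN tS) eqxx.
Qed.

End Classification.

(** * From codes back to templates *)

Definition arc_at (t : code) (e : sign3) : arc :=
  nth (e, e, e) (arcs t) (index e (map (fun a => a.1.1) (arcs t))).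

Definition combi_of_code (t : code) : combi sign3 :=
  Combi sdim sle (fun e => (arc_at t e).1.2) (fun e => (arc_at t e).2) (cN t) (cS t)
    (cWE t) (cEW t) [set v | v \in cW t] [set v | v \in cE t].

Definition unique_overlap (t : code) (p : seq sign3) : bool :=
  let at_edge H e f := all (fun f' => ((f' \in H) && sle e f') == (f' == f)) (cells_of_dim 2) in
  has (fun f => at_edge (cW t) (head (cN t) p) f && has (fun f' =>
    at_edge (cE t) (last (cN t) p) f' && has (fun e => sle e f && sle e f') p)
    (cells_of_dim 2)) (cells_of_dim 2).

(** A certificate that [W] is one whole component: its cells are reached from its first cell, and no
    free cell outside [W] touches it. *)
Definition is_region (t : code) (W : seq sign3) : bool :=
  if W is f :: _ then
    let free := free_cells (cWE t) (cEW t) in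
    [&& f \in free,
        all (mem (region (cWE t) (cEW t) f)) W &
        all (fun v => (v \in W) || ~~ touches W v) free]
  else false.

(** The list [o] certifies acyclicity, since the index in it grows along every edge. *)
Definition code_ok (o : seq sign3) (t : code) : bool :=
  let c := combi_of_code t in
  let pole v := (v == cN t) || (v == cS t) in
  let onm v := on_code_path (cWE t) v || on_code_path (cEW t) v in
  [&& all (fun e => (tl c e != hd c e) && all (fun v =>
        (sle v e && (v != e)) == ((v == tl c e) || (v == hd c e))) all_signs)
        (cells_of_dim 1),
      all (fun e => index (tl c e) o < index (hd c e) o)%N (cells_of_dim 1),
      all (fun v => ((sdim v == 0%N) && all (fun e => hd c e != v) (cells_of_dim 1))
        == (v == cN t)) all_signs,
      all (fun v => ((sdim v == 0%N) && all (fun e => tl c e != v) (cells_of_dim 1))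
        == (v == cS t)) all_signs,
      cdipath c (cN t) (cWE t) (cS t),
      cdipath c (cN t) (cEW t) (cS t),
      all (fun v => (on_code_path (cWE t) v && on_code_path (cEW t) v) == pole v) all_signs,
      is_region t (cW t),
      is_region t (cE t),
      all (fun v => (v \in cW t) (+) (v \in cE t)) (free_cells (cWE t) (cEW t)),
      all (fun e => ((e \in cW t) ==> ~~ onm (tl c e) || pole (tl c e)) &&
                    ((e \in cE t) ==> ~~ onm (hd c e) || pole (hd c e))) (cells_of_dim 1),
      unique_overlap t (cWE t) & unique_overlap t (cEW t)].

Lemma five_codes_ok : all (fun i => code_ok (vertex_order i) (five_codes i)) (iota 0 5).
Proof. by vm_compute. Qed.

Lemma acyclic_of_rank (L : eqType) (c : combi L) (rank : L -> nat) :
  (forall e, dim c e == 1%N -> (rank (tl c e) < rank (hd c e))%N) ->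
  forall v p, cdipath c v p v -> p = [::].
Proof.
move=> up.
have mono u p v : cdipath c u p v -> (rank u + (p != [::]) <= rank v)%N.
  elim: p u => [|e p IH] u /=; first by move=> /eqP ->; rewrite addn0.
  move=> /and3P[de /eqP <- /IH h]; rewrite addn1; apply: leq_trans (up _ de) _.
  exact: leq_trans (leq_addr _ _) h.
by move=> v [//|e p] /mono; rewrite addn1 ltnn.
Qed.

Lemma is_region_linked t W : let c := combi_of_code t in is_region t W ->
  exists2 f, off_meridians c center f &
    [set v | v \in W] = linked sle (off_meridians c center) f.
Proof.
move=> c; case: W => // f W /and3P[/(free_cellsP (c := c) erefl) Xf /allP sub /allP closed].
exists f => //; apply/seteqP; split=> v /=.
  move=> /sub; apply: (explore_sub (c := c) erefl) => [u w uu Xw uw|w|w].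
  - exact: linkedS uu Xw uw.
  - by rewrite mem_filter => /andP[].
  - by rewrite inE => /eqP ->; exact: linked0.
elim=> [|u w _ uW /(free_cellsP (c := c) erefl) Xw uw]; first exact: mem_head.
have /orP[//|/negP[]] := closed _ Xw.
by apply/hasP; exists u.
Qed.

Lemma coverlap_of_code t p : unique_overlap t p -> coverlap (combi_of_code t) p.
Proof.
have at_edge H e f : f \in cells_of_dim 2 ->
    all (fun f' => ((f' \in H) && sle e f') == (f' == f)) (cells_of_dim 2) ->
    unique (cface_at (combi_of_code t) [set v | v \in H] e) f.
  move=> df /allP h; split.
    have := h _ df; rewrite eqxx => /eqP /andP[? ?].
    by split=> //; rewrite /= -mem_cells_of_dim.
  move=> f' [df' Hf' ef']; have := h f'; rewrite mem_cells_of_dim => /(_ df').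
  by rewrite [f' \in H]Hf' [sle e f']ef' => /eqP /esym /eqP ->.
move=> /hasP[f df /andP[uf /hasP[f' df' /andP[uf' /hasP[e ep /andP[ef ef']]]]]].
exists f, f'; split; [exact: at_edge uf|exact: at_edge uf'|].
by exists e.
Qed.

Lemma code_ok_template o t : code_ok o t -> combi_template (combi_of_code t).
Proof.
move=> /and5P[orient rank src snk /and5P[we ew disj W /and5P[E part trans oWE oEW]]].
have edge e : dim (combi_of_code t) e == 1%N -> e \in cells_of_dim 1.
  by rewrite mem_cells_of_dim.
have onmE v : on_meridians (combi_of_code t) v =
  on_code_path (cWE t) v || on_code_path (cEW t) v by [].
have ends e v : sdim e == 1%N -> sdim v == 0%N -> sle v e ->
    v = tl (combi_of_code t) e \/ v = hd (combi_of_code t) e.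
  move=> de dv ve; have ne : v != e by apply: contraTneq dv => ->; rewrite (eqP de).
  move: de; rewrite -(mem_cells_of_dim 1) => /(allP orient) /andP[_ /allP inc].
  have := inc v (mem_all_signs v); rewrite ve ne => /eqP /esym /orP[] /eqP; by [left|right].
split.
- move=> e /edge; move/allP: orient => /[apply] /andP[ne /allP inc]; split=> // v.
  have /eqP := inc v (mem_all_signs v) => E0.
  split=> [[ve /eqP vne]|tv].
    by move: E0; rewrite [sle v e]ve vne => /esym /orP[] /eqP; [left|right].
  have : sle v e && (v != e) by rewrite E0; case: tv => ->; rewrite eqxx ?orbT.
  by move=> /andP[? /eqP].
- apply: (acyclic_of_rank (rank := index^~ o)) => e /edge.
  by move/allP: rank => /[apply].
- move=> v; have /eqP E0 := allP src v (mem_all_signs v).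
  split=> [[dv nh]|vN].
    apply/eqP; rewrite -E0; apply/andP; split=> //; apply/allP => e.
    by rewrite mem_cells_of_dim => de; apply/eqP; exact: nh.
  move: E0; rewrite vN eqxx => /andP[dN /allP nh]; split=> // e /edge /nh.
  by move/eqP.
- move=> v; have /eqP E0 := allP snk v (mem_all_signs v).
  split=> [[dv nh]|vN].
    apply/eqP; rewrite -E0; apply/andP; split=> //; apply/allP => e.
    by rewrite mem_cells_of_dim => de; apply/eqP; exact: nh.
  move: E0; rewrite vN eqxx => /andP[dN /allP nh]; split=> // e /edge /nh.
  by move/eqP.
- exact: we.
- exact: ew.
- move=> v; have /eqP E0 := allP disj v (mem_all_signs v).
  split=> [[v1 v2]|vp].
    move: E0; rewrite [on_code_path _ _]v1 [on_code_path _ _]v2 => /esym/orP[] /eqP;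
      by [left|right].
  apply/andP; rewrite [_ && _]E0.
  by case: vp => ->; rewrite eqxx ?orbT.
- have [f Xf WE] := is_region_linked W; have [g Xg EE] := is_region_linked E.
  set X := off_meridians _ _ in Xf WE Xg EE.
  have freeP v : X v -> v \in free_cells (cWE t) (cEW t).
    by move=> Xv; exact/(free_cellsP (c := combi_of_code t) erefl).
  exists center; split=> //.
    move=> WE_eq; have fW : f \in cW t.
      by rewrite -[is_true _]/([set v | v \in cW t] f) WE; exact: linked0.
    have fE : f \in cE t.
      by rewrite -[is_true _]/(east (combi_of_code t) f) -WE_eq.
    by have := allP part _ (freeP _ Xf); rewrite fW fE.
  move=> P; rewrite /= WE EE -/X; split=> [[v Xv ->]|[|] ->].
  (* Every free cell lies in the west or in the east, and its class is then the class defining that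
     hemisphere. *)
  + have := allP part _ (freeP _ Xv).
    case: (boolP (v \in cW t)) => [vW _|_ vE].
      by left; apply/esym/linked_class => //; rewrite -WE.
    by right; apply/esym/linked_class => //; rewrite -EE.
  + by exists f.
  + by exists g.
- move=> e v ee We dv ve onm vN vS.
  case: (ends _ _ ee dv ve) => // vE; move: (edge _ ee) => /(allP trans) /andP[+ _].
  by rewrite We -vE -onmE onm /= (introF eqP vN) (introF eqP vS).
- move=> e v ee We dv ve onm vN vS.
  case: (ends _ _ ee dv ve) => // vE; move: (edge _ ee) => /(allP trans) /andP[_].
  by rewrite We -vE -onmE onm /= (introF eqP vN) (introF eqP vS).
- exact: coverlap_of_code.
- exact: coverlap_of_code.
Qed.

Lemma five_codes_arc_at (i : nat) a : (i < 5)%N -> a \in arcs (five_codes i) ->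
  arc_at (five_codes i) a.1.1 = a.
Proof.
move=> i5 ai; apply/eqP.
have : all (fun i => all (fun a => arc_at (five_codes i) a.1.1 == a) (arcs (five_codes i)))
  (iota 0 5) by vm_compute.
by move=> /allP /(_ i); rewrite mem_iota => /(_ i5) /allP /(_ a ai).
Qed.

(** Two distinct vertices are adjacent or antipodal, and the symmetries act transitively on the
    ordered pairs of each kind. *)
Lemma pole_symmetry u v : sdim u == 0%N -> sdim v == 0%N -> u != v ->
  exists s, gens s u = vN /\ (gens s v = vS \/ gens s v = axis_vertex 0 false).
Proof.
move=> du dv uv; have : [==> sdim u == 0%N, sdim v == 0%N, u != v =>
    has (fun s => (gens s u == vN) &&
      ((gens s v == vS) || (gens s v == axis_vertex 0 false))) symmetries].
  by move: (v); apply: forall_sign3; move: (u); apply: forall_sign3; vm_compute.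
rewrite du dv uv => /hasP[s _ /andP[/eqP su /orP sv]]; exists s.
by split=> //; case: sv => /eqP; [left|right].
Qed.

(** * Realization on the octahedron and completeness of the list *)

Definition code_template (R : realType) (t : code) : template_data :=
  @TemplateData (octa R) (fun e => (arc_at t e).1.2) (fun e => (arc_at t e).2)
    (cN t) (cS t) (cWE t) (cEW t)
    (@cells (octa R) [set v | v \in cW t]) (@cells (octa R) [set v | v \in cE t]).

Section Realization.
Variable R : realType.

Lemma combi_of_code_template t : combi_of (code_template R t) = combi_of_code t.
Proof.
have hemi (P : set sign3) :
    [set v | @in_hemisphere (code_template R t) (@cells (octa R) P) v] = P.
  by apply/funext => v; rewrite /= /in_hemisphere (cells_sub (octa_regular R)).
by rewrite /combi_of /combi_of_code !hemi /= octa_cell_le.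
Qed.

Lemma code_template_octahedral o t : code_ok o t ->
  octahedral_template R (code_template R t).
Proof.
move=> ok; split; last by exists id, ffun_of_sign3; exact: octa_solid_octahedron.
apply: combi_template_template; first exact: octa_regular.
- by rewrite combi_of_code_template; exact: code_ok_template ok.
- by rewrite combi_of_code_template.
- by rewrite combi_of_code_template.
Qed.

Lemma represents_kappa (d : template_data) (phi : label d -> sign3) psi t :
  represents (combi_map phi psi (combi_of d)) t ->
  represents (combi_map phi psi (combi_of (kappa d))) (code_kappa t).
Proof.
move=> [rarc rN rS rWE rEW rw re]; split=> //=.
- move=> e /rarc h; apply/mapP; exists (e, phi (etail (psi e)), phi (ehead (psi e))) => //.
- by rewrite rEW map_rev.
- by rewrite rWE map_rev.
Qed.

Lemma represents_rho (d : template_data) (phi : label d -> sign3) psi t :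
  represents (combi_map phi psi (combi_of d)) t ->
  represents (combi_map phi psi (combi_of (rho d))) (code_rho t).
Proof. by move=> [rarc rN rS rWE rEW rw re]; split. Qed.

(** A match of codes by a word [s] is realized geometrically: [gens_map s] composed with [f] is the
    required homeomorphism. *)
Lemma represents_isomorphic (d : template_data) f (phi : label d -> sign3) psi t s (i : nat) :
  @complex_isomorphism d (octa R) f phi -> cancel phi psi -> cancel psi phi ->
  hemiW d = cells (west (combi_of d)) -> hemiE d = cells (east (combi_of d)) ->
  represents (combi_map phi psi (combi_of d)) t ->
  (i < 5)%N -> code_match (gens s) t (five_codes i) ->
  template_isomorphic d (code_template R (five_codes i)).
Proof.
move=> iso phiK psiK dW dE [rarc rN rS rWE rEW rw re] i5.
rewrite /code_match; case: eqP => // -[mN mS]; case: eqP => // -[mWE mEW].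
rewrite [~~ true]/=.
case: ifP => // /negbFE /allP marc /allP mhemi.
have arcE e : is_edge e -> arc_at (five_codes i) (gens s (phi e)) =
    (gens s (phi e), gens s (phi (etail e)), gens s (phi (ehead e))).
  move=> de; have := rarc (phi e); rewrite /= phiK => /(_ _)/marc h.
  have /h /(five_codes_arc_at i5) : sdim (phi e) == 1%N.
    by have /= -> := ci_dim iso e.
  by [].
exists (gens_map s \o f), (gens s \o phi).
apply: combi_template_isomorphism => //.
- exact: complex_isomorphism_trans iso (gens_map_isomorphism R s).
- by rewrite combi_of_code_template.
- by rewrite combi_of_code_template.
- by move=> e de /=; rewrite arcE.
- by move=> e de /=; rewrite arcE.
- by rewrite /= -mN rN.
- by rewrite /= -mS rS.
- by rewrite /= -mWE rWE -map_comp.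
- by rewrite /= -mEW rEW -map_comp.
- move=> v; rewrite combi_of_code_template /=.
  have /andP[/eqP -> _] := mhemi _ (mem_all_signs (phi v)).
  by rewrite rw /= phiK.
- move=> v; rewrite combi_of_code_template /=.
  have /andP[_ /eqP ->] := mhemi _ (mem_all_signs (phi v)).
  by rewrite re /= phiK.
Qed.

Lemma octahedral_template_known d : octahedral_template R d ->
  exists i : 'I_5, template_equivalent d (code_template R (five_codes i)).
Proof.
move=> [T [f0 [phi0 iso0]]].
have regd := tpl_regular T.
have [CT dW dE] := template_combi regd T.
have [g1 [psi1 [iso1 _ _ _]]] := complex_isomorphism_sym (octa_solid_octahedron R).
have {iso0 iso1}iso := complex_isomorphism_trans iso0 iso1.
move: iso; set f := (_ \o _); set phi := (_ \o _) => iso.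
have [psi phiK psiK] := ci_bij iso.
have vertex v : is_vertex v -> sdim (phi v) == 0%N.
  by move=> vv; have /= -> := ci_dim iso v.
have [Nv _] := (ct_source CT (poleN d)).2 erefl.
have [Sv _] := (ct_sink CT (poleS d)).2 erefl.
(* With equal poles the meridian would be a closed directed path, hence empty, but the overlap
   condition provides an edge on it. *)
have NS : phi (poleN d) != phi (poleS d).
  rewrite (can_eq phiK); apply/eqP => NS.
  have := ct_WE CT; have [_ [_ [_ _ [e + _]]]] := ct_overlap_WE CT.
  by rewrite /= -NS => eWE /(ct_acyclic CT) WE0; rewrite WE0 in eWE.
have [s0 [s0N s0S]] := pole_symmetry (vertex _ Nv) (vertex _ Sv) NS.
have {}iso := complex_isomorphism_trans iso (gens_map_isomorphism R s0).
move: s0N s0S iso; rewrite -!/((gens s0 \o phi) _).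
set f' := _ \o f; set phi' := _ \o phi => s0N s0S iso.
have [psi' phi'K psi'K] := ci_bij iso.
pose c := combi_map phi' psi' (combi_of d).
have Tc : combi_template c := combi_map_template phi'K psi'K CT.
have dim_c : dim c = sdim.
  by apply/funext => k; rewrite -[k in RHS]psi'K; have /= -> := ci_dim iso (psi' k).
have le_c : le c = sle.
  apply/funext => u; apply/funext => v; rewrite -(octa_cell_le R) /=.
  by rewrite -(complex_isomorphism_leE regd (octa_regular R) iso) !psi'K.
have pNS : pN c <> pS c.
  by rewrite /= s0N; case: s0S => ->.
have search_c : search (pN c) (pS c).
  rewrite /= s0N; case: s0S => ->; [exact: search_adjacent|exact: search_antipodal].
have [t [rep]] := known_of_search Tc dim_c le_c pNS search_c.
move=> /hasP[i i5 /hasP[a _ /hasP[b _ /hasP[s _ m]]]].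
have {}i5 : (i < 5)%N by move: i5; rewrite mem_iota.
exists (Ordinal i5), a, b.
(* The hypotheses on the hemispheres are exchanged in the two cases that involve [kappa]. *)
case: a b m => [] [] m.
- exact: (@represents_isomorphic (kappa (rho d)) f' phi' psi' _ s i iso phi'K psi'K
    dE dW (@represents_kappa (rho d) phi' psi' _ (represents_rho rep)) i5 m).
- exact: (@represents_isomorphic (kappa d) f' phi' psi' _ s i iso phi'K psi'K
    dE dW (represents_kappa rep) i5 m).
- exact: (@represents_isomorphic (rho d) f' phi' psi' _ s i iso phi'K psi'K
    dW dE (represents_rho rep) i5 m).
- exact: (@represents_isomorphic d f' phi' psi' _ s i iso phi'K psi'K
    dW dE rep i5 m).
Qed.

End Realization.

(** * Invariants and the main theorem *)

Lemma card_sign3 (P : pred sign3) : #|P| = count P all_signs.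
Proof.
rewrite -sum1_card -sum1_count; apply: perm_big; apply: uniq_perm => //.
  exact: index_enum_uniq.
by move=> k; rewrite mem_index_enum mem_all_signs.
Qed.

Lemma card_bij (T U : finType) (phi : T -> U) (P : pred T) (Q : pred U) :
  bijective phi -> (forall x, Q (phi x) = P x) -> #|P| = #|Q|.
Proof.
move=> bphi PQ; rewrite -!sum1_card [RHS](reindex phi) /=; last exact: onW_bij.
exact/esym/eq_bigl.
Qed.

Section Invariants.
Implicit Types d : template_data.

Definition out_degree d (v : label d) : nat :=
  #|[pred e : label d | is_edge e && (etail e == v)]|.

Definition degree_product d : nat :=
  \sum_(e : label d | is_edge e) out_degree (etail e) * out_degree (ehead e).

Lemma degree_product_isomorphic d d' :
  template_isomorphic d d' -> degree_product d = degree_product d'.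
Proof.
move=> [f [phi [iso tE hE _ _ _ _ _ _]]]; have bphi := ci_bij iso.
have edge e : is_edge (phi e) = is_edge e by rewrite /is_edge (ci_dim iso).
have out v : out_degree (phi v) = out_degree v.
  apply/esym/(card_bij bphi) => e /=; rewrite edge.
  by case: (boolP (is_edge e)) => //= ee; rewrite tE // (bij_eq bphi).
rewrite /degree_product [RHS](reindex phi) /=; last exact: onW_bij.
apply: eq_big => [e|e ee]; first by rewrite edge.
by rewrite tE // hE // !out.
Qed.

(** Inclusions of images can be pulled back because [f] is injective on the carrier, which contains
    [H]. *)
Lemma face_count_isomorphism d d' (f : ambient d -> ambient d') phi
    (H : set (ambient d)) :
  complex_isomorphism f phi -> H `<=` carrier d ->
  face_count H = @face_count d' (f @` H).
Proof.
move=> iso Hd; have [[g [_ _ _ fK]] _ _ fc] := iso.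
apply: (card_bij (ci_bij iso)) => v /=; rewrite /is_face (ci_dim iso); congr (_ && _).
apply: asbool_equiv_eq; rewrite /in_hemisphere -fc; split; last exact: image_subset.
move=> sub x vx; have [|y Hy fyx] := sub (f x); first by exists x.
have <- : y = x; last by [].
by rewrite -(fK y) ?fyx ?fK //; [exists v|exact: Hd].
Qed.

Lemma west_face_count_isomorphic d d' : template_isomorphic d d' ->
  hemiW d `<=` carrier d -> face_count (hemiW d) = face_count (hemiW d').
Proof.
move=> [f [phi iso]] Hd; rewrite -(ti_W iso).
exact: face_count_isomorphism (ti_complex iso) Hd.
Qed.

End Invariants.

Section FiveTemplates.
Variable R : realType.

Definition five_template (i : 'I_5) : template_data := code_template R (five_codes i).

Lemma face_count_code t (W : seq sign3) :
  @face_count (code_template R t) (@cells (octa R) [set v | v \in W]) =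
  count (fun v => (sdim v == 2%N) && (v \in W)) all_signs.
Proof.
rewrite /face_count card_sign3; apply: eq_count => v /=; congr (_ && _).
by rewrite /in_hemisphere (cells_sub (octa_regular R)) asboolb.
Qed.

Lemma five_face_counts (i : 'I_5) :
  face_count (hemiW (five_template i)) = (if i < 4 then 1 else 2)%N /\
  face_count (hemiE (five_template i)) = (if i < 4 then 7 else 6)%N.
Proof.
rewrite !face_count_code.
by case: i => [[|[|[|[|[|//]]]]] ?]; split; vm_compute.
Qed.

Lemma degree_product_code t : degree_product (code_template R t) =
  let out v := count (fun e => (sdim e == 1%N) && ((arc_at t e).1.2 == v)) all_signs in
  sumn [seq out (arc_at t e).1.2 * out (arc_at t e).2 | e <- cells_of_dim 1]%N.
Proof.
rewrite /degree_product /out_degree sumnE big_map big_filter.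
rewrite (perm_big all_signs) /=; last first.
  apply: uniq_perm => //; first exact: index_enum_uniq.
  by move=> k; rewrite mem_index_enum mem_all_signs.
by apply: eq_bigr => e _; rewrite !card_sign3.
Qed.

(** The value 41 occurs twice because the last two codes have the same orientation; their western
    face counts tell them apart. *)
Lemma five_degree_products (i : 'I_5) :
  degree_product (five_template i) = nth 0%N [:: 45; 39; 44; 41; 41]%N i.
Proof.
rewrite degree_product_code.
by case: i => [[|[|[|[|[|//]]]]] ?]; vm_compute.
Qed.

Lemma five_template_inequivalent (i j : 'I_5) :
  template_equivalent (five_template i) (five_template j) -> i = j.
Proof.
move=> [a [b iso]].
have hemi (H : set sign3) : @cells (octa R) H `<=` carrier (octa R).
  by move=> x [k _ kx]; exists k.
have counts := west_face_count_isomorphic iso.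
have degrees := degree_product_isomorphic iso.
have {iso}[Wij Dij] :
    face_count (hemiW (five_template i)) = face_count (hemiW (five_template j)) /\
    degree_product (five_template i) = degree_product (five_template j).
  case: a b counts degrees {iso} => [] [] counts degrees.
  (* Under [kappa] the western count becomes the eastern one, 7 or 6, which cannot equal 1 or 2. *)
  - have := etrans (esym (five_face_counts i).2) (counts (hemi _)).
    by rewrite (five_face_counts j).1 => /eqP; do 2!case: ifP.
  - have := etrans (esym (five_face_counts i).2) (counts (hemi _)).
    by rewrite (five_face_counts j).1 => /eqP; do 2!case: ifP.
  - by split; [exact: counts (hemi _)|exact: degrees].
  - by split; [exact: counts (hemi _)|exact: degrees].
move: Wij Dij; rewrite !(five_face_counts _).1 !five_degree_products.
by case: i j {counts degrees} => [[|[|[|[|[|//]]]]] ?] [[|[|[|[|[|//]]]]] ?] //= _ _;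
  apply/val_inj.
Qed.

Lemma five_pole_distance i : pole_distance (five_template i) 1.
Proof.
split.
  exists [:: poleS (five_template i)]; split=> //=; rewrite andbT.
  (* This is the edge joining [vN] and [vS], the poles of all five codes. *)
  apply/existsP; exists (edge01 true true).
  by case: i => [[|[|[|[|[|//]]]]] ?]; vm_compute.
move=> [|//] [p [_ NS /size0nil p0]]; move: NS; rewrite p0 {p p0}.
by case: i => [[|[|[|[|[|//]]]]] ?].
Qed.

Lemma five_smaller_face_count i :
  smaller_face_count (five_template i) = (if (i < 4)%N then 1 else 2)%N.
Proof. by rewrite /smaller_face_count; have [-> ->] := five_face_counts i; case: ifP. Qed.

End FiveTemplates.

Theorem mainTheorem3 (R : realType) :
  exists T : 'I_5 -> template_data,
    [/\ (forall i, octahedral_template R (T i)),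
        (forall i j, template_equivalent (T i) (T j) -> i = j),
        (forall d, octahedral_template R d ->
           exists i, template_equivalent d (T i)),
        (forall i, pole_distance (T i) 1)
      & #|[pred i | smaller_face_count (T i) == 1%N]| = 4%N /\
        #|[pred i | smaller_face_count (T i) == 2%N]| = 1%N].
Proof.
exists (@five_template R); split.
- move=> i; apply: (@code_template_octahedral R (vertex_order i)).
  by apply: (allP five_codes_ok); rewrite mem_iota ltn_ord.
- exact: five_template_inequivalent.
- exact: octahedral_template_known.
- exact: five_pole_distance.
have card n : #|[pred i | smaller_face_count (@five_template R i) == n]| =
    #|[pred i : 'I_5 | (if (i < 4)%N then 1 else 2)%N == n]|.
  by apply: eq_card => i; rewrite !inE five_smaller_face_count.
by split; rewrite card -sum1_card big_mkcond !big_ord_recl big_ord0.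
Qed.
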